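(* Let $\mathsf{H}$ be a recursively enumerable pseudovariety of groups and let $\sigma$ be a highly computable implicit signature such that there exists a non-explicit operation $\eta\in\langle\sigma\rangle$ with $\eta=1$ in $\mathsf{H}$. If $\mathsf{H}$ is $\sigma$-reducible, then $\mathsf{DRH}$ is $\sigma$-reducible for systems of idempotent pointlike equations.
   Context: $\mathsf{S}$ is the pseudovariety of all finite semigroups. For a pseudovariety of groups $\mathsf{H}$, $\mathsf{DRH}$ is the pseudovariety of all finite semigroups whose regular $\mathcal{R}$-classes are groups belonging to $\mathsf{H}$. For a pseudovariety $\mathsf{V}$ and a finite set $A$, $\overline{\Omega}_A\mathsf{V}$ is the free pro-$\mathsf{V}$ semigroup on $A$ and $\rho_{\mathsf{V}}:\overline{\Omega}_A\mathsf{S}\to\overline{\Omega}_A\mathsf{V}$ is the canonical projection; elements of $\overline{\Omega}_A\mathsf{S}$ are called pseudowords. $T^I$ denotes the semigroup $T$ with a new identity $I$ adjoined (for $T=\overline{\Omega}_A\mathsf{S}$, $I$ is called the empty word and is an isolated point). For $u,v\in(\overline{\Omega}_A\mathsf{S})^I$, $u=_{\mathsf{V}}v$ means $\rho_{\mathsf{V}}(u)=\rho_{\mathsf{V}}(v)$, where $\rho_{\mathsf{DRH}}(I)=I$ and, for a pseudovariety of groups $\mathsf{H}$, $\rho_{\mathsf{H}}(I)=1$ is the identity element of $\overline{\Omega}_A\mathsf{H}$. Pseudowords are identified with implicit operations (which act on every profinite semigroup); those given by elements of free semigroups $A^+$ are called explicit. An implicit signature $\sigma$ is a set of implicit operations (containing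 multiplication); $\langle\sigma\rangle$ is the implicit signature obtained from $\sigma$ through composition of its elements. $\sigma$ is highly computable if it is a recursively enumerable set and all its elements are computable operations. ''$\eta=1$ in $\mathsf{H}$'' means that $\eta$ takes only the identity as value on every group of $\mathsf{H}$. $\Omega^{\sigma}_A\mathsf{S}$ is the $\sigma$-subalgebra of $\overline{\Omega}_A\mathsf{S}$ generated by $A$; its elements are called $\sigma$-words. A finite system of equations in a finite set of variables $X$ comes with a constraint for each $x\in X$, namely a clopen subset $K_x\subseteq(\overline{\Omega}_A\mathsf{S})^I$ for a finite alphabet $A$. A solution modulo $\mathsf{V}$ of a system $\{u_i=v_i\}_i$ (with $u_i,v_i\in\overline{\Omega}_X\mathsf{S}$) is a continuous homomorphism $\delta:\overline{\Omega}_X\mathsf{S}\to(\overline{\Omega}_A\mathsf{S})^I$ with $\delta(u_i)=_{\mathsf{V}}\delta(v_i)$ for all $i$ and $\delta(x)\in K_x$ for all $x\in X$. It is a solution in $\sigma$-words if $\delta(X)\subseteq(\Omega^{\sigma}_A\mathsf{S})^I$. For a class $\mathcal{C}$ of finite systems, $\mathsf{V}$ is $\sigma$-reducible for $\mathcal{C}$ if, for every system in $\mathcal{C}$ and every choice of clopen constraints, the existence of a solution modulo $\mathsf{V}$ implies the existence of a solution modulo $\mathsf{V}$ in $\sigma$-words. For a finite directed graph $\Gamma=V\uplus E$ (vertices $V$, edges $E$, source map $\alpha:E\to V$, target map $\omega:E\to V$), $\mathcal{S}(\Gamma)$ is the system $\{\alpha(e)\,e=\omega(e) : e\in E\}$ in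 the set of variables $\Gamma$; such systems are called systems of graph equations. $\mathsf{V}$ is called $\sigma$-reducible (with no class mentioned) if it is $\sigma$-reducible for the class of finite systems of graph equations. A system of idempotent pointlike equations is a system of the form $x_1=\cdots=x_n=x_n^2$ with $x_1,\dots,x_n$ variables. *)

(* Defs.v *)
From HB Require Import structures.
From mathcomp Require Import all_boot.
From mathcomp Require Import boolp classical_sets topology.

Set Implicit Arguments.
Unset Strict Implicit.
Unset Printing Implicit Defensive.

Local Open Scope classical_set_scope.
Local Open Scope group_scope.

(* A finite semigroup is given by a multiplication table on {0, ..., n}; in
   particular it is nonempty. All the classes of finite semigroups considered
   are closed under isomorphism, so this loses no generality, and it makes the
   implicit operations below form a small type. *)
Record finsgrp := FinSgrp {
  fs_ord : nat;
  fs_mul : 'I_fs_ord.+1 -> 'I_fs_ord.+1 -> 'I_fs_ord.+1;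
  fs_mulA : associative fs_mul }.

Definition fs_sort (S : finsgrp) : Type := 'I_(fs_ord S).+1.
Coercion fs_sort : finsgrp >-> Sortclass.

HB.instance Definition _ (S : finsgrp) :=
  Finite.copy (fs_sort S) 'I_(fs_ord S).+1.
HB.instance Definition _ (S : finsgrp) :=
  isSemigroup.Build (fs_sort S) (@fs_mulA S).

Definition sgrp_class := finsgrp -> Prop.

Definition all_sgrp : sgrp_class := fun=> True.

Record pseudovariety (V : sgrp_class) : Prop := {
  pv_nonempty : exists S, V S;
  pv_sub : forall (S T : finsgrp) (f : {multiplicative S -> T}),
    injective f -> V T -> V S;
  pv_image : forall (S T : finsgrp) (f : {multiplicative S -> T}),
    range f = setT -> V S -> V T;
  pv_prod : forall (S T P : finsgrp) (f : {multiplicative P -> (S * T)%type}),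
    bijective f -> V S -> V T -> V P }.

Definition is_identity (S : semigroupType) (e : S) : Prop :=
  forall x : S, e * x = x /\ x * e = x.

Definition is_group (S : semigroupType) : Prop :=
  exists2 e : S, is_identity e & forall x, exists y, x * y = e /\ y * x = e.

Definition group_class (V : sgrp_class) : Prop := forall S, V S -> is_group S.

Definition group_pseudovariety (V : sgrp_class) : Prop :=
  pseudovariety V /\ group_class V.

(* x lies in y S^1 *)
Definition R_le (S : semigroupType) (x y : S) : Prop :=
  x = y \/ exists z, x = y * z.

Definition R_class (S : semigroupType) (x : S) : set S :=
  [set y | R_le x y /\ R_le y x].

Definition regular_elt (S : semigroupType) (x : S) : Prop :=
  exists y, x * y * x = x.

(* The regular R-classes are the R-classes of the regular elements. *)
Definition DRH (H : sgrp_class) : sgrp_class := fun S =>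
  forall x : S, regular_elt x ->
    exists (G : finsgrp) (f : {multiplicative G -> S}),
      [/\ H G, injective f & range f = R_class x].

(* The free pro-V semigroup on A, as the semigroup of A-ary implicit operations
   on V. For A empty it is empty, unless V consists of groups, in which case it
   is the trivial group. *)
Record Omega (V : sgrp_class) (A : finType) := MkOmega {
  op : forall S : finsgrp, V S -> (A -> S) -> S;
  op_nat : forall (S T : finsgrp) (VS : V S) (VT : V T)
    (f : {multiplicative S -> T}) (phi : A -> S),
    f (op VS phi) = op VT (f \o phi) }.

Section OmegaStructure.
Variables (V : sgrp_class) (A : finType).
Implicit Types u v w : Omega V A.

Lemma OmegaP u v :
  (forall S (VS : V S) phi, op u VS phi = op v VS phi) -> u = v.
Proof.
case: u v => [f Hf] [g Hg] /= E.
have {}E : f = g.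
  apply: functional_extensionality_dep => S.
  apply: functional_extensionality_dep => VS.
  by apply: funext => phi; exact: E.
by subst g; congr MkOmega; exact: Prop_irrelevance.
Qed.

HB.instance Definition _ := gen_eqMixin (Omega V A).
HB.instance Definition _ := gen_choiceMixin (Omega V A).

Fact Omega_mul_nat u v (S T : finsgrp) (VS : V S) (VT : V T)
    (f : {multiplicative S -> T}) (phi : A -> S) :
  f (op u VS phi * op v VS phi) = op u VT (f \o phi) * op v VT (f \o phi).
Proof. by rewrite gmulfM !(op_nat _ VS VT). Qed.

Definition Omega_mul u v : Omega V A := MkOmega (Omega_mul_nat u v).

Fact Omega_mulA : associative Omega_mul.
Proof. by move=> u v w; apply: OmegaP => S VS phi /=; rewrite mulgA. Qed.

HB.instance Definition _ := isSemigroup.Build (Omega V A) Omega_mulA.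

(* The topology of pointwise convergence, finite semigroups being discrete *)
Definition Omega_subbase : set (set (Omega V A)) :=
  [set B | exists S (VS : V S) (phi : A -> S) (s : S),
             B = [set u | op u VS phi = s]].

HB.instance Definition _ :=
  @isSubBaseTopological.Build (Omega V A) (set (Omega V A)) Omega_subbase id.

Definition gen (a : A) : Omega V A :=
  @MkOmega V A (fun S _ phi => phi a) (fun _ _ _ _ _ _ => erefl).

End OmegaStructure.

Notation pseudoword := (Omega all_sgrp).

Fact rho_nat (V : sgrp_class) (A : finType) (u : pseudoword A)
    (S T : finsgrp) (VS : V S) (VT : V T)
    (f : {multiplicative S -> T}) (phi : A -> S) :
  f (op u (I : all_sgrp S) phi) = op u (I : all_sgrp T) (f \o phi).
Proof. exact: op_nat. Qed.

Definition rho (V : sgrp_class) (A : finType) (u : pseudoword A) : Omega V A :=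
  MkOmega (@rho_nat V A u).

Definition adjI (T : Type) : Type := option T.
Definition emptyw {T : Type} : adjI T := None.
Definition inw {T : Type} (x : T) : adjI T := Some x.

HB.instance Definition _ (T : choiceType) := Choice.copy (adjI T) (option T).

Section AdjMul.
Variable T : semigroupType.

Definition adjI_mul (x y : adjI T) : adjI T :=
  match x, y with
  | None, _ => y
  | _, None => x
  | Some a, Some b => inw (a * b)
  end.

Fact adjI_mulA : associative adjI_mul.
Proof. by move=> [x|] [y|] [z|] //=; rewrite mulgA. Qed.

Fact adjI_1mul : left_id emptyw adjI_mul.
Proof. by case. Qed.

Fact adjI_mul1 : right_id emptyw adjI_mul.
Proof. by case. Qed.

HB.instance Definition _ :=
  isMonoid.Build (adjI T) adjI_mulA adjI_1mul adjI_mul1.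

End AdjMul.

Section AdjTopology.
Variable T : topologicalType.

(* The topology of the disjoint sum of T and the isolated point I *)
Definition adjI_open : set (set (adjI T)) :=
  [set U | open (inw @^-1` U : set T)].

Fact adjI_openT : adjI_open setT.
Proof. exact: openT. Qed.

Fact adjI_openI : setI_closed adjI_open.
Proof. by move=> U W; exact: openI. Qed.

Fact adjI_open_bigU (J : Type) (f : J -> set (adjI T)) :
  (forall j, adjI_open (f j)) -> adjI_open (\bigcup_j f j).
Proof.
move=> fo; rewrite /adjI_open/=; have -> : inw @^-1` (\bigcup_j f j) =
  \bigcup_j (inw @^-1` f j) :> set T by exact: preimage_bigcup.
by apply: bigcup_open => j _; exact: fo.
Qed.

HB.instance Definition _ :=
  isOpenTopological.Build (adjI T) adjI_openT adjI_openI adjI_open_bigU.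

End AdjTopology.

Section OmegaOne.
Variables (V : sgrp_class) (VG : group_class V) (A : finType).

Definition gid (S : finsgrp) (VS : V S) : S := sval (cid2 (VG VS)).

Fact gid_identity (S : finsgrp) (VS : V S) : is_identity (gid VS).
Proof. exact: (svalP (cid2 (VG VS))).1. Qed.

Fact gid_nat (S T : finsgrp) (VS : V S) (VT : V T)
  (f : {multiplicative S -> T}) (phi : A -> S) : f (gid VS) = gid VT.
Proof.
set e := gid VS.
have fe : f e * f e = f e by rewrite -gmulfM (gid_identity VS e).1.
have [e' e'1 inv] := VG VT.
have [y [fy _]] := inv (f e).
have <- : e' = gid VT.
  by rewrite -(gid_identity VT e').2 (e'1 (gid VT)).1.
by rewrite -[LHS](e'1 _).2 -fy mulgA fe.
Qed.

Definition Omega_one : Omega V A := MkOmega gid_nat.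

Lemma Omega_oneP : is_identity Omega_one.
Proof.
by move=> u; split; apply: OmegaP => S VS phi /=;
  rewrite ?(gid_identity VS _).1 ?(gid_identity VS _).2.
Qed.

End OmegaOne.

(* rho_V(I) is 1 if V consists of groups, and I otherwise. *)
Definition rhoI (V : sgrp_class) (A : finType) (u : adjI (pseudoword A)) :
    adjI (Omega V A) :=
  match u with
  | Some w => inw (rho V w)
  | None => if pselect (group_class V) is left VG then inw (Omega_one VG A)
            else emptyw
  end.

Definition eq_mod (V : sgrp_class) (A : finType) (u v : adjI (pseudoword A)) :=
  rhoI V u = rhoI V v.

Definition op_set := forall n : nat, set (pseudoword 'I_n).

Definition implicit_signature (sigma : op_set) : Prop :=
  sigma 2 (gen all_sgrp ord0 * gen all_sgrp ord_max).

(* Evaluation of an n-ary implicit operation in the free profinite semigroup *)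
Section Subst.
Variables (n : nat) (A : finType) (pi : pseudoword 'I_n)
  (w : 'I_n -> pseudoword A).

Fact subst_nat (S T : finsgrp) (VS : all_sgrp S) (VT : all_sgrp T)
    (f : {multiplicative S -> T}) (phi : A -> S) :
  f (op pi VS (fun i => op (w i) VS phi)) =
  op pi VT (fun i => op (w i) VT (f \o phi)).
Proof.
rewrite (op_nat pi VS VT); congr (op pi VT _).
by apply: funext => i /=; rewrite (op_nat (w i) VS VT).
Qed.

Definition subst : pseudoword A := MkOmega subst_nat.

End Subst.

Inductive sigma_word (sigma : op_set) (A : finType) : pseudoword A -> Prop :=
| SigmaGen a : sigma_word sigma (gen all_sgrp a)
| SigmaOp n (pi : pseudoword 'I_n) (w : 'I_n -> pseudoword A) :
    sigma n pi -> (forall i, sigma_word sigma (w i)) ->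
    sigma_word sigma (subst pi w).

(* <sigma>: the operations expressed by the terms over sigma *)
Definition comp_closure (sigma : op_set) : op_set :=
  fun n => [set pi | sigma_word sigma pi].
Arguments comp_closure : clear implicits.

(* The pseudoword given by the word a s *)
Definition word (A : finType) (a : A) (s : seq A) : pseudoword A :=
  foldl (fun u b => u * gen all_sgrp b) (gen all_sgrp a) s.

Definition explicit_op (A : finType) (u : pseudoword A) : Prop :=
  exists a s, u = word a s.

Definition op_one_in (n : nat) (eta : pseudoword 'I_n) (H : sgrp_class) : Prop :=
  forall (G : finsgrp) (phi : 'I_n -> G),
    H G -> is_identity (op eta (I : all_sgrp G) phi).

(* Partial recursive functions. A list that is too short is read as if it were
   padded with zeros, except by [Prec]. *)
Inductive prog : Type :=
| Zero
| Succ
| Proj of nat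
| Comp of prog & seq prog
| Prec of prog & prog
| Mu of prog.

Inductive eval : prog -> seq nat -> nat -> Prop :=
| EvZero s : eval Zero s 0
| EvSucc s : eval Succ s (nth 0 s 0).+1
| EvProj i s : eval (Proj i) s (nth 0 s i)
| EvComp f gs s vs v : size vs = size gs ->
    (forall i, i < size gs -> eval (nth Zero gs i) s (nth 0 vs i)) ->
    eval f vs v -> eval (Comp f gs) s v
| EvPrec0 f g s v : eval f s v -> eval (Prec f g) (0 :: s) v
| EvPrecS f g n s u v : eval (Prec f g) (n :: s) u ->
    eval g (n :: u :: s) v -> eval (Prec f g) (n.+1 :: s) v
| EvMu f s n (k : nat -> nat) :
    (forall m, m < n -> eval f (m :: s) (k m).+1) ->
    eval f (n :: s) 0 -> eval (Mu f) s n.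

Definition re_set (P : set nat) : Prop :=
  exists p, forall n, P n <-> exists v, eval p [:: n] v.

(* Goedel numbers of multiplication tables, and of tuples of elements;
   [CodeSeq.code] is a computable bijection from [seq nat] to [nat]. *)
Definition code_sgrp (S : finsgrp) : nat :=
  CodeSeq.code (fs_ord S ::
    [seq nat_of_ord (fs_mul i j) |
      i <- enum 'I_(fs_ord S).+1, j <- enum 'I_(fs_ord S).+1]).

Definition code_args (S : finsgrp) (n : nat) (phi : 'I_n -> S) : nat :=
  CodeSeq.code [seq nat_of_ord (phi i : 'I_(fs_ord S).+1) | i <- enum 'I_n].

Definition re_class (V : sgrp_class) : Prop :=
  re_set [set code_sgrp S | S in V].

(* With the numbers [aux] as first inputs, [p] computes the value of [pi] from a
   finite semigroup and a tuple of its elements. *)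
Definition computes (p : prog) (aux : seq nat) (n : nat) (pi : pseudoword 'I_n) :
    Prop :=
  forall (S : finsgrp) (phi : 'I_n -> S),
    eval p (aux ++ [:: code_sgrp S; code_args phi])
      (nat_of_ord (op pi (I : all_sgrp S) phi : 'I_(fs_ord S).+1)).

Definition computable_op (n : nat) (pi : pseudoword 'I_n) : Prop :=
  exists p, computes p [::] pi.

(* The operations of sigma can be listed effectively: the k-th one has the arity
   computed by [ar] at k and is computed by [p] with k as auxiliary input. As
   sigma contains the multiplication, the list may be taken to be infinite. *)
Definition re_signature (sigma : op_set) : Prop :=
  exists ar p : prog,
    (forall k, exists n (pi : pseudoword 'I_n),
       [/\ sigma n pi, eval ar [:: k] n & computes p [:: k] pi]) /\
    (forall n (pi : pseudoword 'I_n), sigma n pi ->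
       exists k, eval ar [:: k] n /\ computes p [:: k] pi).

Definition highly_computable (sigma : op_set) : Prop :=
  re_signature sigma /\
  forall n (pi : pseudoword 'I_n), sigma n pi -> computable_op pi.

Record system := System {
  vars : finType;
  eqns : seq (pseudoword vars * pseudoword vars) }.

Definition solution (V : sgrp_class) (Sys : system) (A : finType)
    (K : vars Sys -> set (adjI (pseudoword A)))
    (delta : {multiplicative pseudoword (vars Sys) -> adjI (pseudoword A)}) :
    Prop :=
  [/\ continuous delta,
      forall u v, (u, v) \in eqns Sys -> eq_mod V (delta u) (delta v) &
      forall x, K x (delta (gen all_sgrp x))].

Definition in_sigma_words (sigma : op_set) (X A : finType)
    (delta : pseudoword X -> adjI (pseudoword A)) : Prop :=
  forall x, delta (gen all_sgrp x) = emptyw \/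
    exists2 w, sigma_word sigma w & delta (gen all_sgrp x) = inw w.

Definition reducible (sigma : op_set) (V : sgrp_class) (C : system -> Prop) :
    Prop :=
  forall Sys : system, C Sys ->
  forall (A : finType) (K : vars Sys -> set (adjI (pseudoword A))),
    (forall x, clopen (K x)) ->
    (exists delta, solution V K delta) ->
    exists delta, solution V K delta /\ in_sigma_words sigma delta.

Record digraph := Digraph {
  vertex : finType;
  edge : finType;
  source : edge -> vertex;
  target : edge -> vertex }.

Definition graph_system (Gamma : digraph) : system :=
  @System (vertex Gamma + edge Gamma)%type
    [seq (gen all_sgrp (inl (source e)) * gen all_sgrp (inr e),
          gen all_sgrp (inl (target e))) | e <- enum (edge Gamma)].

Definition graph_systems (Sys : system) : Prop :=
  exists Gamma, Sys = graph_system Gamma.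

(* The system x_1 = ... = x_n = x_n^2 in the variables X, for the nonempty list
   x_1, ..., x_n given as [x :: s] *)
Definition pointlike_system (X : finType) (x : X) (s : seq X) : system :=
  @System X
    (rcons (pairmap (fun y z => (gen all_sgrp y, gen all_sgrp z)) x s)
       (gen all_sgrp (last x s),
        gen all_sgrp (last x s) * gen all_sgrp (last x s))).

Definition idempotent_pointlike_systems (Sys : system) : Prop :=
  exists (X : finType) (x : X) (s : seq X), Sys = pointlike_system x s.

(* Main.v *)
Require Import Defs.
From HB Require Import structures.
From Stdlib Require List.
From mathcomp Require Import all_boot.
From mathcomp Require Import boolp classical_sets topology finmap.

Set Implicit Arguments.
Unset Strict Implicit.
Unset Printing Implicit Defensive.
Local Open Scope classical_set_scope.
Local Open Scope group_scope.

(** Let u_1, ..., u_n be pseudowords that are equal and idempotent modulo DRH,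
    and let phi be a homomorphism into a finite semigroup T fine enough to see
    the constraints, the letters and the contents. The goal is to find
    sigma-words w_i with the same images under phi that are still equal and
    idempotent modulo DRH.

    Two facts about DRH carry the proof. First, a pseudoword factors as
    u = x a y, where a is a letter outside the content of x, and when u is
    known modulo DRH so are x and y: for S in DRH, the semigroup that records the
    values in S of the parts of a word before and after its first occurrence of
    a belongs to DRH again ([split_DRH], [split_uniq]). Choosing a so that x contains all the other
    letters of u gives the left basic factorization, which can be iterated on
    y. Second, if e is an idempotent of a semigroup in DRH and e is a product
    involving all the letters of B, then s |-> e s is a homomorphism
    from the words over B into the R-class of e, which is a group of H
    ([pow_absorbs_into_group]). So behind an infinite power of q, a factor r
    with content inside that of q matters modulo DRH only through its value
    modulo H.

    A family (u_i), constant modulo DRH, is therefore treated by induction on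
    its content B. If after finitely many left basic factors the content of
    the remainder drops, all pieces have a smaller content or are letters.
    Otherwise take many factors of content B; by the pigeonhole principle two
    prefixes p_i and p_i q_i have the same image under phi for every i. Write
    u_i = p_i r_i. Then p_i eta(q_i) r_i has the same image under phi, for
    eta(q) the non-explicit operation of the hypothesis evaluated at
    (q, ..., q); it equals p_i r_i modulo H since eta = 1 in H; and modulo DRH
    it depends on r_i only through its value modulo H. The smaller problems
    for p_i and q_i are solved by induction, and that for r_i is a problem
    modulo H alone.

    Idempotency of the w_i modulo DRH requires w_i = 1 modulo H, so the choices
    made at different places cannot be independent. This is why the induction
    does not produce sigma-words at once: it produces a list of families, each
    constant modulo H, whose product is u_i modulo H, together with a recipe
    that turns any replacement of these families by sigma-words into sigma-words
    w_i whose value modulo H is the product of the replacements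
    ([realizable]). The condition that the product is 1 modulo H says that the
    families label a cycle in a graph, with n parallel edges at each step, and
    H-reducibility for graph equations provides the replacements
    ([group_replacement]). If u_i is idempotent modulo DRH, then
    each remainder y of its iterated left basic factorization satisfies
    y = y u_i modulo DRH, hence its content never drops ([blocks]); the resulting
    w_i = p_i eta(q_i) r_i with p_i r_i = 1 modulo H is idempotent modulo DRH.

    Pseudowords are handled throughout by density rather than compactness: on finitely many finite semigroups a pseudoword acts like
    some word ([density]), and a rule which on any two finite semigroups acts
    like a word is given by a pseudoword ([pseudoword_of_values]). *)

(** * Finite semigroups on arbitrary finite types *)

Definition hom_of (S T : magmaType) (f : S -> T)
    (fM : {morph f : x y / x * y}) : {multiplicative S -> T} :=
  HB.pack f (isMultiplicative.Build S T f fM).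

HB.instance Definition _ (T : finType) := Finite.copy (adjI T) (option T).

Section Table.
Variables (T : finType) (mul : T -> T -> T).
Hypothesis mulA : associative mul.
Variable x0 : T.

Fact table_card : #|T| = #|T|.-1.+1.
Proof. by rewrite prednK //; apply/card_gt0P; exists x0. Qed.

Definition code (x : T) : 'I_#|T|.-1.+1 := cast_ord table_card (enum_rank x).
Definition uncode (i : 'I_#|T|.-1.+1) : T :=
  enum_val (cast_ord (esym table_card) i).

Fact codeK : cancel code uncode.
Proof. by move=> x; rewrite /code /uncode cast_ordK enum_rankK. Qed.

Fact uncodeK : cancel uncode code.
Proof. by move=> x; rewrite /code /uncode enum_valK cast_ordKV. Qed.

Fact table_mulA : associative (fun i j => code (mul (uncode i) (uncode j))).
Proof. by move=> i j k; rewrite !codeK mulA. Qed.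

Definition table : finsgrp := FinSgrp table_mulA.

(* Locked, so that unification does not mistake a product of the table for a
   value of [enc]. *)
Definition enc (x : T) : table := locked (code x).
Definition dec (i : table) : T := uncode i.

Lemma encK : cancel enc dec.
Proof. by move=> x; rewrite /enc -lock; exact: codeK. Qed.

Lemma decK : cancel dec enc.
Proof. by move=> x; rewrite /enc -lock; exact: uncodeK. Qed.

Lemma encM x y : enc (mul x y) = enc x * enc y.
Proof. by rewrite -{1}(encK x) -{1}(encK y) {1}/enc -lock. Qed.

Lemma decM i j : dec (i * j) = mul (dec i) (dec j).
Proof. by rewrite -{1}(decK i) -{1}(decK j) -encM encK. Qed.

End Table.

(** * Pseudowords act like words on finitely many finite semigroups *)

Section Evaluation.
Variable A : finType.
Implicit Types (u v : pseudoword A) (x y : adjI (pseudoword A)) (w : seq A).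

Definition ev (S : finsgrp) (phi : A -> S) u : S :=
  op u (Logic.I : all_sgrp S) phi.

Lemma evM (S : finsgrp) (phi : A -> S) u v :
  ev phi (u * v) = ev phi u * ev phi v.
Proof. by []. Qed.

Lemma ev_gen (S : finsgrp) (phi : A -> S) a : ev phi (gen all_sgrp a) = phi a.
Proof. by []. Qed.

Lemma ev_nat (S T : finsgrp) (f : {multiplicative S -> T}) (phi : A -> S) u :
  f (ev phi u) = ev (f \o phi) u.
Proof. exact: op_nat. Qed.

Lemma ev_ext u v : (forall (S : finsgrp) (phi : A -> S), ev phi u = ev phi v) ->
  u = v.
Proof. by move=> E; apply: OmegaP => S [] phi; apply: E. Qed.

Definition evI (S : finsgrp) (phi : A -> S) x : adjI S := omap (ev phi) x.

Lemma evIM (S : finsgrp) (phi : A -> S) x y :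
  evI phi (x * y) = evI phi x * evI phi y.
Proof. by case: x y => [u|] [v|]. Qed.

Lemma evI_ext x y :
  (forall (S : finsgrp) (phi : A -> S), evI phi x = evI phi y) -> x = y.
Proof.
have tA : associative (fun _ _ : unit => tt) by [].
case: x y => [u|] [v|] // E; last 2 first.
- by have := E (table tA tt) (fun=> enc tA tt tt).
- by have := E (table tA tt) (fun=> enc tA tt tt).
by congr Some; apply: ev_ext => S phi; have [] := E S phi.
Qed.

(** The value lies in S with an identity adjoined, so that the empty word, which
    occurs as a factor, needs no separate treatment. *)
Definition word_value (S : semigroupType) (phi : A -> S) w : adjI S :=
  \prod_(b <- w) inw (phi b).

Section Words.
Variables (S : semigroupType) (phi : A -> S).

Lemma word_value_nil : word_value phi [::] = emptyw.
Proof. by rewrite /word_value big_nil. Qed.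

Lemma word_value_cons a w :
  word_value phi (a :: w) = inw (phi a) * word_value phi w.
Proof. by rewrite /word_value big_cons. Qed.

Lemma word_value_cat w1 w2 :
  word_value phi (w1 ++ w2) = word_value phi w1 * word_value phi w2.
Proof. by rewrite /word_value big_cat. Qed.

Lemma word_value_eq_nil w : word_value phi w = emptyw -> w = [::].
Proof. by case: w => // a w; rewrite word_value_cons; case: word_value. Qed.

End Words.

Lemma word_value_nat (S T : semigroupType) (f : {multiplicative S -> T})
  (phi : A -> S) w : omap f (word_value phi w) = word_value (f \o phi) w.
Proof.
elim: w => [|a w IH]; first by rewrite !word_value_nil.
rewrite !word_value_cons -IH; case: (word_value phi w) => //= s.
by rewrite gmulfM.
Qed.

(** Over an empty alphabet an implicit operation would pick a canonical element in
    each finite semigroup; the two constant endomorphisms of a two-element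
    semilattice exclude this. *)
Lemma pseudoword_letter u : exists a : A, True.
Proof.
apply: contrapT => NA.
have E (S : finsgrp) (p q : A -> S) : p = q.
  by apply: funext => a; case: NA; exists a.
have bA : associative orb by move=> [] [] [].
pose B := table bA true.
pose f (b : bool) (_ : B) : B := enc bA true b.
have fM b : {morph f b : x y / x * y} by move=> x y; rewrite /f -encM orbb.
have X b : enc bA true b = ev (fun=> enc bA true true) u.
  by rewrite -[LHS]/(hom_of (fM b) (ev (fun=> enc bA true true) u)) ev_nat;
    congr (ev _ u); apply: E.
have := etrans (X true) (esym (X false)).
by move=> /(congr1 (@dec _ _ bA true)); rewrite !encK.
Qed.

(** The values of words form a subsemigroup containing the generators, and
    implicit operations commute with its inclusion. *)
Lemma density1 (S : finsgrp) (phi : A -> S) u :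
  exists w, inw (ev phi u) = word_value phi w.
Proof.
pose Q (s : S) := `[< exists w, inw s = word_value phi w >].
have Qphi a : Q (phi a).
  by apply/asboolP; exists [:: a]; rewrite word_value_cons word_value_nil.
have QM (s t : S) : Q s -> Q t -> Q (s * t).
  move=> /asboolP[v sv] /asboolP[w tw]; apply/asboolP; exists (v ++ w).
  by rewrite word_value_cat -sv -tw.
pose U := {s : S | Q s}.
pose m (s t : U) : U := exist _ (val s * val t) (QM _ _ (valP s) (valP t)).
have mA : associative m by move=> s t r; apply: val_inj; rewrite /= mulgA.
have [a _] := pseudoword_letter u.
pose g b : U := exist _ (phi b) (Qphi b).
pose f (x : table mA (g a)) : S := val (dec x).
have fM : {morph f : x y / x * y} by move=> x y; rewrite /f decM.
have := ev_nat (hom_of fM) (@enc _ _ mA (g a) \o g) u.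
have -> : hom_of fM \o (@enc _ _ mA (g a) \o g) = phi.
  by apply: funext => b; rewrite /= /f encK.
by move=> <-; have /asboolP := valP (dec (ev (@enc _ _ mA (g a) \o g) u)).
Qed.

(** Topologically: the finite quotients of the free profinite semigroup form a
    directed system. *)
Lemma dominate (D : finType) (S : D -> finsgrp) (phi : forall d, A -> S d) :
  exists (P : finsgrp) (psi : A -> P) (f : forall d, {multiplicative P -> S d}),
    forall d, phi d = f d \o psi.
Proof.
pose U := {dffun forall d : D, S d}.
pose m (s t : U) : U := [ffun d => s d * t d].
have mA : associative m.
  by move=> s t r; apply/ffunP => d; rewrite !ffunE mulgA.
pose x0 : U := [ffun d => (ord0 : 'I_(fs_ord (S d)).+1) : S d].
pose f d (x : table mA x0) : S d := dec x d.
have fM d : {morph f d : x y / x * y} by move=> x y; rewrite /f decM ffunE.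
exists (table mA x0), (fun a => enc mA x0 [ffun d => phi d a]).
exists (fun d => hom_of (fM d)) => d.
by apply: funext => a; rewrite /= /f encK ffunE.
Qed.

Lemma density (D : finType) (S : D -> finsgrp) (phi : forall d, A -> S d) u :
  exists w, forall d, inw (ev (phi d) u) = word_value (phi d) w.
Proof.
have [P [psi [f E]]] := dominate phi.
have [w Ew] := density1 psi u; exists w => d.
by rewrite E -ev_nat -word_value_nat -Ew.
Qed.

Lemma density2 (S T : finsgrp) (phi : A -> S) (psi : A -> T) u :
  exists w, inw (ev phi u) = word_value phi w /\
    inw (ev psi u) = word_value psi w.
Proof.
have [w Ew] := @density bool (fun b => if b then S else T)
  (fun b => if b return A -> if b then S else T then phi else psi) u.
by exists w; split; [apply: (Ew true)|apply: (Ew false)].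
Qed.

Lemma density3 (S T R : finsgrp) (phi : A -> S) (psi : A -> T) (chi : A -> R) u :
  exists w, [/\ inw (ev phi u) = word_value phi w,
    inw (ev psi u) = word_value psi w & inw (ev chi u) = word_value chi w].
Proof.
have [P [p [f E]]] := @dominate bool (fun b => if b then S else T)
  (fun b => if b return A -> if b then S else T then phi else psi).
have [w [Ep Ec]] := density2 p chi u.
exists w; split => //.
- by rewrite (E true) -ev_nat -word_value_nat -Ep.
- by rewrite (E false) -ev_nat -word_value_nat -Ep.
Qed.

End Evaluation.

(** * Open sets of pseudowords *)

Section Topology.
Variable A : finType.
Implicit Types (U : set (pseudoword A)) (u v : pseudoword A).

(** A basic open set imposes finitely many conditions, which one finite quotient
    sees at once; [local_open] is the converse. *)
Lemma open_local U : open U -> forall u, U u ->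
  exists (S : finsgrp) (phi : A -> S),
    forall v, ev phi v = ev phi u -> U v.
Proof.
move=> oU; have [D' sD <-] : exists2 D' : set (set (pseudoword A)),
  D' `<=` finI_from (@Omega_subbase all_sgrp A) id & \bigcup_(B in D') B = U := oU.
move=> u [B DB Bu].
have [F sF EB] := sD B DB.
have sub (d : F) : exists X : {S : finsgrp & A -> S}, forall v,
    ev (projT2 X) v = ev (projT2 X) u -> (\val d : set (pseudoword A)) v.
  have /set_mem := sF _ (fsvalP d); move=> [S [VS [phi [s Es]]]].
  exists (existT _ S phi) => v /= Ev; rewrite Es /= in Bu *.
  have : [set u : pseudoword A | op u VS phi = s] u.
    by rewrite -Es; move: Bu; rewrite -EB; apply; exact: fsvalP.
  by rewrite /=; case: VS Es => Es <-.
have [X PX] := choice sub.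
have [P [psi [f E]]] := dominate (fun d => projT2 (X d)).
exists P, psi => v Ev; exists B => //; rewrite -EB => i Fi.
by apply: (PX [` Fi]%fset); rewrite E -!ev_nat Ev.
Qed.

Lemma local_open U : (forall u, U u -> exists (S : finsgrp) (phi : A -> S),
    forall v, ev phi v = ev phi u -> U v) -> open U.
Proof.
move=> loc.
exists [set B | finI_from (@Omega_subbase all_sgrp A) id B /\ B `<=` U].
  by move=> B [].
apply/seteqP; split=> [u [B [_]]|u Uu]; first exact.
have [S [phi Ev]] := loc u Uu.
exists [set v | op v (Logic.I : all_sgrp S) phi = ev phi u] => //.
split; last by move=> v /= /Ev.
apply: (@finI_from1 _ _ (@Omega_subbase all_sgrp A) id).
by exists S, Logic.I, phi, (ev phi u).
Qed.

Lemma clopen_ev (S : finsgrp) (phi : A -> S) (s : S) :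
  clopen [set x : adjI (pseudoword A) | evI phi x = inw s].
Proof.
split.
  apply: local_open => u /= us; exists S, phi => v Ev; move: us.
  by rewrite /preimage /= Ev.
rewrite -openC; apply: local_open => u /= us; exists S, phi => v Ev; move: us.
by rewrite /preimage /= Ev.
Qed.

End Topology.

(** * Constructing pseudowords from their values *)

Section Gluing.
Variable A : finType.

(** Naturality, the only condition on an implicit operation, concerns two
    semigroups at a time, so it can be read off from a word describing both
    values. The empty value occurs everywhere or nowhere for the same reason. *)
Lemma pseudoword_of_values (F : forall S : finsgrp, (A -> S) -> adjI S) :
  (forall (S T : finsgrp) (phi : A -> S) (psi : A -> T),
     exists w, F S phi = word_value phi w /\ F T psi = word_value psi w) ->
  exists x : adjI (pseudoword A), forall (S : finsgrp) (phi : A -> S),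
    evI phi x = F S phi.
Proof.
move=> FP; case: (pselect (exists S phi, F S phi = emptyw)) => [[S [phi E]]|NE].
  exists emptyw => T psi; have [w [E1 E2]] := FP S T phi psi.
  by rewrite E2 (@word_value_eq_nil _ _ phi w) ?word_value_nil // -E1 E.
have get (S : finsgrp) (phi : A -> S) : {s : S | F S phi = inw s}.
  case E : (F S phi) => [s|]; first by exists s.
  by case: NE; exists S, phi; rewrite E.
have nat (S T : finsgrp) (VS : all_sgrp S) (VT : all_sgrp T)
    (f : {multiplicative S -> T}) (phi : A -> S) :
    f (sval (get S phi)) = sval (get T (f \o phi)).
  case: (get S phi) (get T (f \o phi)) => [s Es] [t Et] /=.
  have [w [E1 E2]] := FP S T phi (f \o phi).
  by move: E2; rewrite -word_value_nat -E1 Es Et => -[].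
exists (inw (MkOmega nat)) => S phi; rewrite /evI /= /ev /=.
by case: (get S phi).
Qed.

End Gluing.

(** * Homomorphisms that may send variables to the empty word *)

Section Extension.
Variables (X A : finType) (theta : X -> adjI (pseudoword A)).

Definition adj_table (S : finsgrp) : finsgrp :=
  @table (adjI S) (@mul (adjI S)) (@mulgA (adjI S)) emptyw.

Definition adj_enc (S : finsgrp) (x : adjI S) : adj_table S :=
  @enc (adjI S) (@mul (adjI S)) (@mulgA (adjI S)) emptyw x.
Definition adj_dec (S : finsgrp) (x : adj_table S) : adjI S :=
  @dec (adjI S) (@mul (adjI S)) (@mulgA (adjI S)) emptyw x.

Lemma adj_encK (S : finsgrp) (x : adjI S) : adj_dec (adj_enc x) = x.
Proof. exact: encK. Qed.

Lemma adj_decM (S : finsgrp) (x y : adj_table S) :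
  adj_dec (x * y) = adj_dec x * adj_dec y.
Proof. exact: decM. Qed.

Lemma adj_dec_word_value (S : finsgrp) (phi : X -> adjI S) w x :
  inw x = word_value (fun b => adj_enc (phi b)) w ->
  adj_dec x = \prod_(b <- w) phi b.
Proof.
elim: w x => [|a w IH] x; first by rewrite word_value_nil.
rewrite word_value_cons big_cons; case E : word_value => [y|] [->]; last first.
  by rewrite (word_value_eq_nil E) big_nil mulg1 adj_encK.
by rewrite -(IH y) // adj_decM adj_encK.
Qed.

Let G (S : finsgrp) (phi : A -> S) b := adj_enc (evI phi (theta b)).

Lemma substitution_value (u : pseudoword X) : exists x : adjI (pseudoword A),
  forall (S : finsgrp) (phi : A -> S), evI phi x = adj_dec (ev (G phi) u).
Proof.
apply: (@pseudoword_of_values A (fun S phi => adj_dec (ev (G phi) u))) => S T phi psi.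
have [w [E1 E2]] := density2 (G phi) (G psi) u.
rewrite (adj_dec_word_value E1) (adj_dec_word_value E2).
elim: w {E1 E2} => [|b w [w' [IH1 IH2]]].
  by exists [::]; rewrite !big_nil !word_value_nil.
have [v [Ev1 Ev2]] : exists v, evI phi (theta b) = word_value phi v /\
    evI psi (theta b) = word_value psi v.
  case: (theta b) => [t|] /=; last by exists [::]; rewrite !word_value_nil.
  exact: density2.
by exists (v ++ w'); rewrite !big_cons IH1 IH2 Ev1 Ev2 !word_value_cat.
Qed.

(** The value of the substituted pseudoword in S is computed in S with an identity
    adjoined, where the variables sent to the empty word act trivially. *)
Lemma substitution_exists :
  exists delta : {multiplicative pseudoword X -> adjI (pseudoword A)},
  continuous delta /\ forall x, delta (gen all_sgrp x) = theta x.
Proof.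
have [d Pd] := choice substitution_value.
have dM : {morph d : u v / u * v}.
  by move=> u v; apply: evI_ext => S phi; rewrite evIM !Pd evM adj_decM.
exists (hom_of dM); split; last first.
  by move=> x; apply: evI_ext => S phi; rewrite Pd ev_gen adj_encK.
apply/continuousP => U oU; apply: local_open => u /= Uu.
case Eu : (d u) Uu => [y|] Uu; last first.
  have tA : associative (fun _ _ : unit => tt) by [].
  pose phi (a : A) := enc tA tt tt.
  exists (adj_table (table tA tt)), (G phi) => v Ev.
  have : evI phi (d v) = evI phi (d u) by rewrite !Pd Ev.
  by rewrite /preimage /= Eu; case: (d v).
have [S [phi L]] := open_local oU Uu.
exists (adj_table S), (G phi) => v Ev.
have : evI phi (d v) = evI phi (d u) by rewrite !Pd Ev.
rewrite /preimage /= Eu; case: (d v) => //= z [Ez]; exact: L.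
Qed.

End Extension.

(** * Content *)

Section Content.
Variable A : finType.

Definition content_sgrp : finsgrp :=
  @table {set A} (@finset.setU A) (@finset.setUA A) finset.set0.
Definition content_gen (a : A) : content_sgrp :=
  enc (@finset.setUA A) finset.set0 [set a]%SET.

Definition cont (u : pseudoword A) : {set A} := dec (ev content_gen u).
Definition contI (x : adjI (pseudoword A)) : {set A} :=
  if x is Some u then cont u else finset.set0.

Lemma contIM x y : contI (x * y) = contI x :|: contI y.
Proof.
case: x y => [u|] [v|] //=; rewrite ?finset.setU0 ?finset.set0U //; exact: decM.
Qed.

Lemma contM u v : cont (u * v) = cont u :|: cont v.
Proof. exact: (contIM (inw u) (inw v)). Qed.

Lemma cont_gen a : cont (gen all_sgrp a) = [set a]%SET.
Proof. exact: encK. Qed.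

Lemma word_value_content w : word_value content_gen w =
  if w is [::] then emptyw
  else inw (enc (@finset.setUA A) finset.set0 [set x in w]).
Proof.
elim: w => [|a w IH]; first exact: word_value_nil.
rewrite word_value_cons IH; case: w {IH} => [|b w] /=; congr inw.
  by congr enc; apply/setP => x; rewrite !inE.
rewrite /content_gen -encM; congr enc; apply/setP => x.
by rewrite finset.in_setU [in RHS]inE [in RHS]in_cons !inE.
Qed.

Lemma cont_word_value u w :
  inw (ev content_gen u) = word_value content_gen w -> cont u = [set x in w].
Proof.
by rewrite word_value_content; case: w => // a w [E]; rewrite /cont E; apply: encK.
Qed.

Lemma contI_word_value x w :
  evI content_gen x = word_value content_gen w -> contI x = [set x in w].
Proof.
case: x => [u|]; first exact: cont_word_value.
by case: w => [|a w]; [move=> _; apply/setP=> b; rewrite !inE |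
  rewrite word_value_content].
Qed.

Lemma cont_neq0 u : cont u != finset.set0.
Proof.
have [[|a w] Ew] := density1 content_gen u; first by rewrite word_value_nil in Ew.
by rewrite (cont_word_value Ew); apply/set0Pn; exists a; rewrite !inE eqxx.
Qed.

End Content.

(** * Splitting at the first occurrence of a letter *)

Section SplitSemigroup.
Variables (S : finsgrp) (c : S).

(** For a letter a with value c, [inl s] is the value of a word without a, and
    [inr (s0, s1)] stands for a word w0 a w1 such that a does not occur in w0,
    with s0 and s1 the values of w0 and w1. *)
Definition split_mul (x y : S + adjI S * adjI S) : S + adjI S * adjI S :=
  match x, y with
  | inl s, inl t => inl (s * t)
  | inl s, inr (t0, t1) => inr (inw s * t0, t1)
  | inr (s0, s1), inl t => inr (s0, s1 * inw t)
  | inr (s0, s1), inr (t0, t1) =>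
      inr (s0, s1 * t0 * inw c * t1)
  end.

Lemma split_mulA : associative split_mul.
Proof.
have inwM (s t : S) : inw (s * t) = inw s * inw t by [].
by move=> [s|[s0 s1]] [t|[t0 t1]] [r|[r0 r1]] /=; rewrite ?inwM ?mulgA.
Qed.

Definition split_sgrp : finsgrp := table split_mulA (inr (emptyw, emptyw)).
Definition split_enc (x : S + adjI S * adjI S) : split_sgrp :=
  enc split_mulA (inr (emptyw, emptyw)) x.
Definition split_dec (x : split_sgrp) : S + adjI S * adjI S := dec x.

Lemma split_encK : cancel split_enc split_dec. Proof. exact: encK. Qed.
Lemma split_decK : cancel split_dec split_enc. Proof. exact: decK. Qed.
Lemma split_encM x y : split_enc x * split_enc y = split_enc (split_mul x y).
Proof. by rewrite /split_enc encM. Qed.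
Lemma split_enc_inj : injective split_enc. Proof. exact: can_inj split_encK. Qed.

End SplitSemigroup.

Section SplitWords.
Variables (A : finType) (a : A) (S : finsgrp) (phi : A -> S).

Definition split_gen (b : A) : split_sgrp (phi a) :=
  split_enc (phi a) (if b == a then inr (emptyw, emptyw) else inl (phi b)).

Lemma word_value_split_notin w : a \notin w ->
  word_value split_gen w =
  omap (fun s => split_enc (phi a) (inl s)) (word_value phi w).
Proof.
elim: w => [|b w IH]; first by rewrite !word_value_nil.
rewrite inE negb_or eq_sym => /andP[ba aw].
rewrite !word_value_cons IH // /split_gen (negbTE ba).
by case: (word_value phi w) => [s|] //=; congr inw; rewrite split_encM.
Qed.

Lemma word_value_split_cons w :
  word_value split_gen (a :: w) =
  inw (split_enc (phi a) (inr (emptyw, word_value phi w))).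
Proof.
elim/last_ind: w => [|w b IH].
  by rewrite word_value_cons !word_value_nil /split_gen eqxx.
rewrite -cats1 -cat_cons !word_value_cat IH !word_value_cons !word_value_nil /split_gen.
have [->|ba] := eqVneq b a; congr inw; rewrite split_encM /=;
  congr (split_enc _ (inr (emptyw, _))).
by rewrite !mulg1.
Qed.

Lemma word_value_split w0 w1 : a \notin w0 ->
  word_value split_gen (w0 ++ a :: w1) =
  inw (split_enc (phi a) (inr (word_value phi w0, word_value phi w1))).
Proof.
move=> aw; rewrite word_value_cat word_value_split_notin // word_value_split_cons.
by case: (word_value phi w0) => [s|] //=; congr inw; rewrite split_encM.
Qed.

End SplitWords.

Section SplitPseudowords.
Variable A : finType.
Implicit Types (u v : pseudoword A) (x y : adjI (pseudoword A)) (a : A).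

Lemma densityI3 (S T R : finsgrp) (phi : A -> S) (psi : A -> T) (chi : A -> R) x :
  exists w, [/\ evI phi x = word_value phi w, evI psi x = word_value psi w &
    evI chi x = word_value chi w].
Proof.
by case: x => [u|]; [exact: density3|exists [::]; rewrite !word_value_nil].
Qed.

Lemma evI_split a (S : finsgrp) (phi : A -> S) x y : a \notin contI x ->
  evI (split_gen a phi) (x * inw (gen all_sgrp a) * y) =
  inw (split_enc (phi a) (inr (evI phi x, evI phi y))).
Proof.
move=> ax.
have [w0 [E1 E2 E3]] := densityI3 (split_gen a phi) phi (@content_gen A) x.
have [w1 [F1 F2 F3]] := densityI3 (split_gen a phi) phi (@content_gen A) y.
rewrite !evIM E1 F1 -mulgA.
have -> : evI (split_gen a phi) (inw (gen all_sgrp a)) * word_value (split_gen a phi) w1 =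
  word_value (split_gen a phi) (a :: w1) by rewrite word_value_cons.
rewrite -word_value_cat word_value_split ?E2 ?F2 //.
by move: ax; rewrite (contI_word_value E3) inE.
Qed.

(** Both factors are recovered from the action of u on the splitting semigroups. *)
Lemma split_at_letter u a : a \in cont u -> exists x y,
  inw u = x * inw (gen all_sgrp a) * y /\ a \notin contI x.
Proof.
move=> au.
have key (S : finsgrp) (phi : A -> S) (T : finsgrp) (psi : A -> T) :
    exists w0 w1,
  [/\ a \notin w0,
      inw (ev phi u) = word_value phi w0 * inw (phi a) * word_value phi w1,
      split_dec (ev (split_gen a phi) u) = inr (word_value phi w0, word_value phi w1) &
      split_dec (ev (split_gen a psi) u) = inr (word_value psi w0, word_value psi w1)].
  have [P [p [f E]]] := @dominate A bool (fun b => if b then S else content_sgrp A)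
    (fun b => if b return A -> if b then S else content_sgrp A
              then phi else @content_gen A).
  have [w [E1 E2 E3]] := density3 p (split_gen a phi) (split_gen a psi) u.
  have Ephi : inw (ev phi u) = word_value phi w.
    by rewrite (E true) -ev_nat -word_value_nat -E1.
  have aw : a \in w.
    have Esl : inw (ev (@content_gen A) u) = word_value (@content_gen A) w.
      by rewrite (E false) -ev_nat -word_value_nat -E1.
    by move: au; rewrite (cont_word_value Esl) inE.
  move: (index_mem a w) (aw) => /esym E0 _.
  pose w0 := take (index a w) w; pose w1 := drop (index a w).+1 w.
  have Ew : w = w0 ++ a :: w1.
    by rewrite -{1}(cat_take_drop (index a w) w) (drop_nth a) ?index_mem // nth_index.
  have aw0 : a \notin w0.
    apply/negP => /(nthP a)[i]; rewrite size_take index_mem aw => li.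
    rewrite nth_take // => Ei; have := li; rewrite -Ei.
    by move=> li'; have := before_find a li; rewrite /= Ei eqxx.
  exists w0, w1; split => //.
  - by rewrite Ephi Ew word_value_cat word_value_cons mulgA.
  - by move: E2; rewrite Ew word_value_split // => -[->]; rewrite split_encK.
  - by move: E3; rewrite Ew word_value_split // => -[->]; rewrite split_encK.
pose F (i : bool) (S : finsgrp) (phi : A -> S) : adjI S :=
  if split_dec (ev (split_gen a phi) u) is inr (s0, s1)
  then if i then s0 else s1 else emptyw.
have [x Ex] : exists x : adjI (pseudoword A), forall (S : finsgrp) (phi : A -> S),
    evI phi x = F true S phi.
  apply: pseudoword_of_values => S T phi psi.
  by have [w0 [w1 [_ _ E1 E2]]] := key S phi T psi; exists w0; rewrite /F E1 E2.
have [y Ey] : exists y : adjI (pseudoword A), forall (S : finsgrp) (phi : A -> S),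
    evI phi y = F false S phi.
  apply: pseudoword_of_values => S T phi psi.
  by have [w0 [w1 [_ _ E1 E2]]] := key S phi T psi; exists w1; rewrite /F E1 E2.
exists x, y; split.
  apply: evI_ext => S phi; rewrite !evIM Ex Ey /F.
  by have [w0 [w1 [_ E1 E2 _]]] := key S phi S phi; rewrite E2 -E1.
have [w0 [w1 [aw0 _ E1 _]]] := key _ (@content_gen A) _ (@content_gen A).
by rewrite (@contI_word_value _ x w0) ?inE //; rewrite Ex /F E1.
Qed.

(** If the part before a misses another letter b of u, then b occurs after a, and
    splitting there instead makes the first factor longer in content. *)
Lemma left_basic_factorization u : exists a x y,
  [/\ inw u = x * inw (gen all_sgrp a) * y,
  a \notin contI x, a \in cont u & contI x = cont u :\ a].
Proof.
suff [a [x [y [E ax sub]]]] : exists a x y,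
    [/\ inw u = x * inw (gen all_sgrp a) * y, a \notin contI x &
      cont u :\ a \subset contI x].
  exists a, x, y.
  have Ec : cont u = contI x :|: [set a]%SET :|: contI y.
    by rewrite -[cont u]/(contI (inw u)) E !contIM /= cont_gen.
  have au : a \in cont u by rewrite Ec !inE eqxx orbT.
  split=> //; apply/eqP; rewrite finset.eqEsubset sub andbT.
  apply/fintype.subsetP => b bx; rewrite finset.in_setD1 Ec !inE bx /= andbT.
  by apply: contraNneq ax => <-.
have /set0Pn[a au] := cont_neq0 u.
suff H n : forall a x y,
    inw u = x * inw (gen all_sgrp a) * y -> a \notin contI x ->
    #|cont u :\: contI x| <= n -> exists a x y,
    [/\ inw u = x * inw (gen all_sgrp a) * y, a \notin contI x &
      cont u :\ a \subset contI x].
  by have [x [y [E ax]]] := split_at_letter au; exact: H E ax (leqnn _).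
elim: n => [|n IH] {au}a x y E ax.
  rewrite leqn0 cards_eq0 finset.setD_eq0 => cux; move: ax.
  rewrite (fintype.subsetP cux) //.
  by rewrite -[cont u]/(contI (inw u)) E !contIM /= cont_gen !inE eqxx orbT.
move=> len; have [sub|/fintype.subsetPn[b]] := boolP (cont u :\ a \subset contI x).
  by exists a, x, y.
rewrite finset.in_setD1 => /andP[ba bu] bx.
have := bu; rewrite -{1}[cont u]/(contI (inw u)) {1}E !contIM.
rewrite [contI (inw _)]/= cont_gen.
rewrite finset.in_setU finset.in_setU finset.in_set1 (negbTE ba) (negbTE bx) /=.
case: y E => [v|] E; last by rewrite inE.
move=> bv; have [x2 [y2 [E2 bx2]]] := split_at_letter bv.
have bx' : b \notin contI (x * inw (gen all_sgrp a) * x2).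
  by rewrite !contIM /= cont_gen !inE negb_or bx2 andbT negb_or bx.
apply: (IH b (x * inw (gen all_sgrp a) * x2) y2) => //.
  by rewrite E [Some v]E2 !mulgA.
rewrite -ltnS; apply: leq_trans len; apply: proper_card.
apply/properP; split.
  by apply: finset.setDS; rewrite !contIM -finset.setUA finset.subsetUl.
exists a; rewrite !inE ?ax /=.
  by rewrite -[cont u]/(contI (inw u)) E !contIM /= cont_gen !inE eqxx orbT.
by rewrite !contIM /= cont_gen !inE eqxx orbT.
Qed.

End SplitPseudowords.

(** * Finite groups given as semigroups *)

Lemma group_inverse (G : finsgrp) : is_group G -> exists (e : G) (i : G -> G),
  [/\ is_identity e, forall x, x * i x = e & forall x, i x * x = e].
Proof.
move=> [e eP inv]; have [i iP] := choice inv.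
by exists e, i; split=> // x; have [] := iP x.
Qed.

Lemma group_idem (G : finsgrp) (g : G) : is_group G -> g * g = g -> is_identity g.
Proof.
move=> /group_inverse[e [i [eP ri li]]] gg.
suff -> : g = e by [].
by rewrite -[LHS](eP g).2 -(ri g) mulgA gg.
Qed.

Lemma group_cancel (G : finsgrp) (g x y : G) : is_group G -> g * x = g * y -> x = y.
Proof.
move=> /group_inverse[e [i [eP ri li]]] E.
by rewrite -(eP x).1 -(eP y).1 -(li g) -!mulgA E.
Qed.

Lemma group_swap (G : finsgrp) (x y : G) : is_group G ->
  is_identity (x * y) -> is_identity (y * x).
Proof.
move=> GG xy; apply: group_idem => //.
by rewrite mulgA -(mulgA y) (xy y).2.
Qed.

(** * Semigroups in DRH *)

Section DRH.
Variable H : sgrp_class.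
Hypothesis HG : group_pseudovariety H.

Lemma trivial_in : exists (S : finsgrp) (s : S), H S /\ forall x : S, x = s.
Proof.
have [[[S HS] _ im _] _] := HG.
have tA : associative (fun _ _ : unit => tt) by [].
pose t := enc tA tt tt.
have tt1 (x : table tA tt) : x = t by rewrite -(decK x); case: (dec x).
exists (table tA tt), t; split=> //.
have fM : {morph (fun _ : S => t) : x y / x * y} by move=> x y; rewrite [RHS]tt1.
apply: (im S _ (hom_of fM)) => //.
apply/seteqP; split=> // x _; exists (ord0 : 'I_(fs_ord S).+1) => //.
Qed.

Lemma semilattice_DRH (S : finsgrp) :
  (forall x : S, x * x = x) -> (forall x y : S, x * y = y * x) -> DRH H S.
Proof.
move=> idS cS x _; have [G [g [HG' g1]]] := trivial_in.
have fM : {morph (fun _ : G => x) : y z / y * z} by move=> y z; rewrite idS.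
exists G, (hom_of fM); split => //; first by move=> y z _; rewrite (g1 y) (g1 z).
apply/seteqP; split=> [y [z _ <-]|y]; first by split; left.
rewrite /R_class /= => -[xy yx]; exists g => //=.
have E1 : y * x = x by case: xy => [->|[z ->]] //; rewrite mulgA idS.
have E2 : x * y = y by case: yx => [->|[z ->]] //; rewrite mulgA idS.
by rewrite -E1 cS E2.
Qed.

Lemma group_class_sub_DRH (S : finsgrp) : H S -> DRH H S.
Proof.
move=> HS x _; have idM : {morph (@id S) : y z / y * z} by [].
exists S, (hom_of idM); split=> //.
have [e [i [eP ri li]]] := group_inverse (HG.2 S HS).
apply/seteqP; split=> [y _|y _]; last by exists y.
by split; right; [exists (i y * x)|exists (i x * y)];
  rewrite mulgA ri (eP _).1.
Qed.

Lemma not_group_DRH : ~ group_class (DRH H).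
Proof.
have bA : associative orb by move=> [] [] [].
move=> /(_ (table bA true)) []; first apply: semilattice_DRH.
- by move=> x; rewrite -(decK x) -encM orbb.
- by move=> x y; rewrite -(decK x) -(decK y) -!encM orbC.
move=> e eP /(_ (enc bA true true)) [y [E _]].
have /(congr1 (@dec _ _ bA true)) := (eP (enc bA true false)).1.
by rewrite -E !decM !encK.
Qed.

Lemma content_DRH (A : finType) : DRH H (content_sgrp A).
Proof.
apply: semilattice_DRH.
  by move=> x; rewrite -(decK x) -encM finset.setUid.
by move=> x y; rewrite -(decK x) -(decK y) -!encM finset.setUC.
Qed.

Lemma DRH_group (S : finsgrp) (x : S) : DRH H S -> regular_elt x ->
  exists (G : finsgrp) (f : {multiplicative G -> S}) (e : G) (i : G -> G),
    [/\ H G, injective f, range f = R_class x, is_identity e &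
      forall x, x * i x = e /\ i x * x = e].
Proof.
move=> DS /DS [G [f [HG' fi rf]]].
have [e [i [eP ri li]]] := group_inverse (HG.2 G HG').
by exists G, f, e, i.
Qed.

Section Split.
Variables (S : finsgrp) (c : S).
Hypothesis DS : DRH H S.

Local Notation "<< x >>" := (split_enc c x).

Lemma R_le_inl (s : S) Z : R_le << inl s >> << Z >> ->
  exists2 t, Z = inl t & R_le s t.
Proof.
case=> [/split_enc_inj <-|[z]]; first by exists s => //; left.
rewrite -(split_decK z) split_encM => /split_enc_inj.
case: Z (split_dec z) => [t|[t0 t1]] [r|[r0 r1]] //=.
by move=> [->]; exists t => //; right; exists r.
Qed.

Lemma R_le_inr (s0 : adjI S) (s : S) Z : R_le << Z >> << inr (s0, Some s) >> ->
  exists2 t, Z = inr (s0, Some t) & R_le t s.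
Proof.
case=> [/split_enc_inj ->|[z]]; first by exists s => //; left.
rewrite -(split_decK z) split_encM => /split_enc_inj ->.
case: (split_dec z) => [r|[r0 r1]] //=.
  by exists (s * r) => //; right; exists r.
case: r0 r1 => [r0|] [r1|] //=; rewrite -?mulgA.
- by exists (s * (r0 * (c * r1))) => //; right; eexists.
- by exists (s * (r0 * c)) => //; right; eexists.
- by exists (s * (c * r1)) => //; right; eexists.
- by exists (s * c) => //; right; eexists.
Qed.

Lemma inl_R_le (s t : S) : R_le s t -> R_le << inl s >> << inl t >>.
Proof.
by case=> [->|[r ->]]; [left|right; exists << inl r >>; rewrite split_encM].
Qed.

Lemma inr_R_le (s0 : adjI S) (s t : S) : R_le s t ->
  R_le << inr (s0, Some s) >> << inr (s0, Some t) >>.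
Proof.
by case=> [->|[r ->]]; [left|right; exists << inl r >>; rewrite split_encM].
Qed.

(** A regular element (s0, s1) has s1 = s with s v C s = s for some v, where C is
    s0 c. Its R-class consists of the (s0, t) with t in the R-class G of s, and is
    multiplied by (s0, t) (s0, t') = (s0, t C t'). As t C = t h for an element h
    of the group G, the map k |-> (s0, h^-1 k) is an isomorphism from G. *)
Lemma split_DRH : DRH H (split_sgrp c).
Proof.
move=> x; rewrite -(split_decK x) => -[y].
rewrite -(split_decK y) !split_encM => /split_enc_inj.
case: (split_dec x) => [s|[s0 s1]].
  case: (split_dec y) => [t|[t0 t1]] //= [sts].
  have [G [f [HG' fi rf]]] := DS (ex_intro _ t sts).
  have fM : {morph (fun g => << inl (f g) >>) : x y / x * y}.
    by move=> g h; rewrite gmulfM split_encM.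
  exists G, (hom_of fM); split => //; first by move=> g h /split_enc_inj[] /fi.
  apply/seteqP; split=> [z [g _ <-]|z].
    have : R_class s (f g) by rewrite -rf; exists g.
    by move=> [sg gs]; split; apply: inl_R_le.
  rewrite -(split_decK z) /R_class /= => -[/R_le_inl[t' -> st] ts].
  have [r [<-] t's] := R_le_inl ts.
  have : R_class s t' by [].
  by rewrite -rf => -[g _ <-]; exists g.
pose C : S := if s0 is Some s then s * c else c.
have CE : s0 * inw c = inw C by rewrite /C; case: (s0).
move=> yE.
have [s [v [Es svs]]] : exists s (v : S), s1 = Some s /\ s * v * C * s = s.
  move: yE; case: (split_dec y) => [t|[t0 t1]] /= [].
    have -> : s1 * inw t * s0 * inw c * s1 =
      s1 * inw t * (s0 * inw c) * s1 by rewrite !mulgA.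
    by rewrite CE; case: s1 => [s|] // [E]; exists s, t.
  have -> : s1 * t0 * inw c * t1 * s0 * inw c * s1 =
    s1 * (t0 * inw c * t1) * (s0 * inw c) * s1 by rewrite !mulgA.
  rewrite CE; case: s1 => [s|]; last by case: t0 t1 => [?|] [?|].
  case E : (t0 * inw c * t1) => [v|]; last by case: t0 t1 E => [?|] [?|].
  by move=> -[E']; exists s, v.
subst s1.
have regs : regular_elt s by exists (v * C); rewrite mulgA.
have [G [f [e [i [HG' fi rf eP iP]]]]] := DRH_group DS regs.
have [g _ gE] : range f (s * v).
  rewrite rf; split; right; last by exists v.
  by exists (C * s); rewrite mulgA.
have [g2 _ g2E] : range f (s * v * C).
  rewrite rf; split; right; first by exists s.
  by exists (v * C); rewrite mulgA.
pose h := i g * g2.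
have hP k : f k * C = f (k * h).
  rewrite /h !gmulfM g2E -gE !mulgA -!gmulfM.
  by rewrite -(mulgA k) (iP g).2 (eP k).2.
move: h hP => h hP; have [h' [h'h hh']] : exists h', h' * h = e /\ h * h' = e.
  by exists (i h); split; [exact: (iP h).2|exact: (iP h).1].
have fM : {morph (fun k => << inr (s0, Some (f (h' * k))) >>) : x y / x * y}.
  move=> k k'; rewrite split_encM /=; congr (split_enc _ (inr (_, _))).
  have -> : inw (f (h' * k)) * s0 * inw c * inw (f (h' * k')) =
    inw (f (h' * k)) * (s0 * inw c) * inw (f (h' * k')) by rewrite !mulgA.
  rewrite CE; congr Some; rewrite -[RHS]/(f (h' * k) * C * f (h' * k')) hP -gmulfM.
  by rewrite -!mulgA (mulgA h h') hh' (eP k').1.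
have h'hK k : h' * (h * k) = k by rewrite mulgA h'h (eP k).1.
have hh'K k : h * (h' * k) = k by rewrite mulgA hh' (eP k).1.
exists G, (hom_of fM); split => //.
  by move=> k k' /split_enc_inj[/fi E]; rewrite -(hh'K k) E hh'K.
apply/seteqP; split=> [z [k _ <-]|z].
  have : R_class s (f (h' * k)) by rewrite -rf; exists (h' * k).
  by move=> [sg gs]; split; apply: inr_R_le.
rewrite -(split_decK z) /R_class /= => -[xz /R_le_inr[t Et ts]].
have [r] : exists2 r,
    inr (s0, Some s) = inr (s0, Some r) :> S + adjI S * adjI S & R_le r t.
  by rewrite Et in xz; exact: R_le_inr.
move=> [<-] st; have : R_class s t by [].
by rewrite -rf => -[k _ kE]; exists (h * k) => //=; rewrite h'hK kE Et.
Qed.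

End Split.

End DRH.

(** * Equality modulo a pseudovariety *)

Section EqI.
Variable A : finType.
Implicit Types (u v : pseudoword A) (x y : adjI (pseudoword A)) (V : sgrp_class).

(** Unlike [eq_mod], this keeps the empty word apart from the identity of a
    group also when V consists of groups. *)
Definition eqI V x y := forall (S : finsgrp) (phi : A -> S), V S ->
  evI phi x = evI phi y.

Lemma eqI_refl V x : eqI V x x. Proof. by []. Qed.

Lemma eqI_sym V x y : eqI V x y -> eqI V y x.
Proof. by move=> E S phi VS; rewrite E. Qed.

Lemma eqI_trans V x y z : eqI V x y -> eqI V y z -> eqI V x z.
Proof. by move=> E E' S phi VS; rewrite E ?E'. Qed.

Lemma eqI_mul V x x' y y' : eqI V x x' -> eqI V y y' -> eqI V (x * y) (x' * y').
Proof. by move=> E E' S phi VS; rewrite !evIM E ?E'. Qed.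

Lemma eqI_mulw V u u' v v' : eqI V (inw u) (inw u') -> eqI V (inw v) (inw v') ->
  eqI V (inw (u * v)) (inw (u' * v')).
Proof. exact: (eqI_mul (x := inw _) (y := inw _)). Qed.

Lemma eqI_ev V u v : eqI V (inw u) (inw v) ->
  forall (S : finsgrp) (phi : A -> S), V S -> ev phi u = ev phi v.
Proof. by move=> E S phi VS; have [] := E S phi VS. Qed.

Lemma ev_eqI V u v :
  (forall (S : finsgrp) (phi : A -> S), V S -> ev phi u = ev phi v) ->
  eqI V (inw u) (inw v).
Proof. by move=> E S phi VS; rewrite /evI /= E. Qed.

Section DRH.
Variable H : sgrp_class.
Hypothesis HG : group_pseudovariety H.

Lemma eqI_DRH x y : eqI (DRH H) x y -> eqI H x y.
Proof. by move=> E S phi HS; apply: E; apply: group_class_sub_DRH. Qed.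

Lemma eqI_cont x y : eqI (DRH H) x y -> contI x = contI y.
Proof.
move=> /(_ _ (@content_gen A) (content_DRH HG (A:=A))).
case: x y => [u|] [v|] //= [E].
by rewrite /cont E.
Qed.

Lemma eqI_emptyw x : eqI (DRH H) x emptyw -> x = emptyw.
Proof. by move=> /(_ _ (@content_gen A) (content_DRH HG (A:=A))); case: x. Qed.

(** Apply the splitting semigroup over each member of DRH, which is in DRH itself. *)
Lemma split_uniq a x1 y1 x2 y2 :
  eqI (DRH H) (x1 * inw (gen all_sgrp a) * y1) (x2 * inw (gen all_sgrp a) * y2) ->
  a \notin contI x1 -> a \notin contI x2 ->
  eqI (DRH H) x1 x2 /\ eqI (DRH H) y1 y2.
Proof.
move=> E a1 a2; split=> S phi DS;
  by have := E _ (split_gen a phi) (split_DRH HG (c := phi a) DS);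
    rewrite !evI_split // => -[/split_enc_inj[]].
Qed.

End DRH.

End EqI.

(** * Infinite powers *)

Lemma word_value_word (A : finType) (S : finsgrp) (phi : A -> S) a s :
  inw (ev phi (word a s)) = word_value phi (a :: s).
Proof.
elim/last_ind: s => [|s b IH]; first by rewrite word_value_cons word_value_nil.
rewrite -cats1 -cat_cons word_value_cat -IH word_value_cons word_value_nil.
by rewrite /word foldl_cat.
Qed.

(** If only short words described eta on some S, then, these being finitely many
    and all different from eta, finitely many semigroups would together exclude
    every word, against density. *)
Lemma nonexplicit_long_words n (eta : pseudoword 'I_n) : ~ explicit_op eta ->
  forall (S : finsgrp) (phi : 'I_n -> S) N,
  exists2 w, inw (ev phi eta) = word_value phi w & N <= size w.
Proof.
move=> nex S phi N; apply: contrapT => short.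
have sep (w : seq 'I_n) : exists X : {S : finsgrp & 'I_n -> S},
    inw (ev (projT2 X) eta) <> word_value (projT2 X) w.
  apply: contrapT => all; have all' (T : finsgrp) (psi : 'I_n -> T) :
      inw (ev psi eta) = word_value psi w.
    by apply: contrapT => ne; apply: all; exists (existT _ T psi).
  case: w all all' => [|a s] _ E; first by have := E S phi; rewrite word_value_nil.
  apply: nex; exists a, s; apply: ev_ext => T psi.
  by have := E T psi; rewrite -word_value_word => -[].
have [X PX] := choice sep.
pose Y (d : option (N.-bseq 'I_n)) : {S : finsgrp & 'I_n -> S} :=
  if d is Some w then X w else existT _ S phi.
have [w Pw] := density (fun d => projT2 (Y d)) eta.
have [leN|ltN] := leqP N (size w).
  by apply: short; exists w => //; exact: (Pw None).
by apply: (PX w); exact: (Pw (Some (Bseq (ltnW ltN)))).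
Qed.

Lemma idem_power (S : finsgrp) (s : S) : let x : adjI S := inw s in
  exists k N, [/\ 0 < k, x ^+ k * x ^+ k = x ^+ k &
    forall m, N <= m -> x ^+ k * x ^+ m = x ^+ m].
Proof.
move=> x; pose g (i : 'I_#|{: adjI S}|.+1) := x ^+ i.
have [i [j [lij gij]]] : exists i j : nat, i < j /\ x ^+ i = x ^+ j.
  have /injectivePn[i [j nij gij]] : ~~ injectiveb g.
    apply/negP => /injectiveP /leq_card; rewrite card_ord ltnn //.
  case: (ltngtP i j) => [lij|lji|/val_inj E]; last by rewrite E eqxx in nij.
    by exists i, j.
  by exists j, i.
have per m : i <= m -> x ^+ (m + (j - i)) = x ^+ m.
  move=> /subnKC <-; rewrite -addnA (addnC (m - i)) addnA subnKC ?(ltnW lij) //.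
  by rewrite !expgnDr gij.
have perc c m : i <= m -> x ^+ (m + c * (j - i)) = x ^+ m.
  move=> im; elim: c => [|c IH]; first by rewrite addn0.
  by rewrite mulSn addnCA addnC per ?IH // (leq_trans im) ?leq_addr.
have p0 : 0 < j - i by rewrite subn_gt0.
exists (i.+1 * (j - i))%N, i; split=> [||m im]; first by rewrite muln_gt0.
- by rewrite -expgnDr perc // (leq_trans (leqnSn i)) ?leq_pmulr.
- by rewrite -expgnDr addnC perc.
Qed.

Section Pow.
Variables (H : sgrp_class) (n : nat) (eta : pseudoword 'I_n).
Hypotheses (HG : group_pseudovariety H) (nex : ~ explicit_op eta)
  (one : op_one_in eta H).
Variable A : finType.
Implicit Types (q z : pseudoword A).

Definition pow q : pseudoword A := subst eta (fun=> q).

Lemma pow_large (S : finsgrp) (phi : A -> S) q N :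
  exists2 m, N <= m & inw (ev phi (pow q)) = (inw (ev phi q) : adjI S) ^+ m.
Proof.
have [w Ew lw] := nonexplicit_long_words nex (fun=> ev phi q) N.
exists (size w) => //; rewrite -[ev phi (pow q)]/(ev (fun=> ev phi q) eta) Ew.
by elim: w {Ew lw} => [|b w IH]; rewrite ?word_value_nil // word_value_cons IH expgS.
Qed.

Lemma pow_stab (S : finsgrp) (phi : A -> S) q (t : S) :
  t * ev phi q = t -> t * ev phi (pow q) = t.
Proof.
move=> E; have [m _ Em] := pow_large phi q 0.
suff [] : inw (t * ev phi (pow q)) = inw t by [].
rewrite -[LHS]/(inw t * inw (ev phi (pow q))) Em.
elim: m {Em} => [|m IH]; first by rewrite mulg1.
by rewrite expgS mulgA -[inw t * inw _]/(inw (t * ev phi q)) E.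
Qed.

Lemma cont_pow q : cont (pow q) = cont q.
Proof.
rewrite /cont; congr dec; have [m m1 Em] := pow_large (@content_gen A) q 1.
set t := ev _ q in Em *.
have tt : t * t = t by rewrite -(decK t) -encM finset.setUid.
suff : inw (ev (@content_gen A) (pow q)) = inw t by case.
rewrite Em; case: m m1 {Em} => // m _.
elim: m => [|m IH] //; rewrite expgS IH; exact: congr1 tt.
Qed.

Lemma pow_one (G : finsgrp) (psi : A -> G) q : H G -> is_identity (ev psi (pow q)).
Proof. exact: one. Qed.

Lemma R_le_adj (S : finsgrp) (s t : S) (z : adjI S) :
  inw s = inw t * z -> R_le s t.
Proof. by case: z => [z|] [->]; [right; exists z|left]. Qed.

(** Let s be the value of q, and e an idempotent power of s, so that the R-class of
    e is a group with identity e. For b in the content of q, write s = x b y; then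
    e x and e x b lie in that group, hence so does e b. If g is in the
    group then g b = g e b, so left multiplication by e is a homomorphism on
    the words over the content of q. Finally the value of [pow q] is a power of s with
    a large exponent, thus fixed by e and in the group, where eta = 1 makes it
    equal to e. *)
Lemma pow_absorbs_into_group (S : finsgrp) (phi : A -> S) q : DRH H S ->
  exists (G : finsgrp) (f : {multiplicative G -> S}) (psi : A -> G) (e : G),
    [/\ H G, is_identity e, ev phi (pow q) = f e &
      forall z, cont z \subset cont q ->
        ev phi (pow q) * ev phi z = f (ev psi z)].
Proof.
move=> DS; have [k [N [k0 idk abk]]] := idem_power (ev phi q).
set x : adjI S := inw (ev phi q) in idk abk.
have [e0 Ee0] : exists e0, x ^+ k = inw e0.
  case: k k0 {idk abk} => // k _; elim: k => [|k [e0 E]]; first by exists (ev phi q).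
  by exists (ev phi q * e0); rewrite expgS E.
have e0e0 : e0 * e0 = e0 by move: idk; rewrite Ee0 => -[].
have [|G [f [e [i [HG' fi rf eP iP]]]]] := DRH_group HG DS (_ : regular_elt e0).
  by exists e0; rewrite !e0e0.
have fe : f e = e0.
  have [g _ ge0] : range f e0 by rewrite rf; split; left.
  suff -> : e = g by [].
  have gg : g * g = g by apply: fi; rewrite gmulfM ge0.
  by rewrite -[LHS](group_idem (HG.2 G HG') gg e).1 (eP g).2.
have letter b : exists g, b \in cont q -> e0 * phi b = f g.
  have [bq|] := boolP (b \in cont q); last by exists e.
  have [w [Ew Esl]] := density2 phi (@content_gen A) q.
  move: bq; rewrite (cont_word_value Esl) inE => bw.
  case/splitPr: bw Ew {Esl} => w1 w2; rewrite word_value_cat word_value_cons => Ew.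
  set X := word_value phi w1 in Ew; pose Y := word_value phi w2 * x ^+ k.-1.
  have EXY : inw e0 = inw e0 * X * inw (phi b) * Y.
    have Ex : x = X * (inw (phi b) * word_value phi w2) := Ew.
    rewrite -{1}e0e0 -[LHS]/(inw e0 * inw e0) -{2}Ee0 -(prednK k0) expgS {1}Ex.
    by rewrite /Y !mulgA.
  move: X Y EXY {Ew} => X Y EXY.
  have inR (y : S) Z W : inw y = inw e0 * Z -> inw e0 = inw y * W ->
      exists g, f g = y.
    move=> E1 E2; have [g _ gy] : range f y.
      by rewrite rf; split; [exact: R_le_adj E2|exact: R_le_adj E1].
    by exists g.
  have [y1 E1] : exists y1, inw y1 = inw e0 * X.
    by case: (X) => [t|]; [exists (e0 * t)|exists e0].
  have [g1 g1E] : exists g, f g = y1.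
    by apply: (inR _ _ (inw (phi b) * Y) E1); rewrite EXY -E1 mulgA.
  have E2 : inw (y1 * phi b) = inw y1 * inw (phi b) by [].
  have [g2 g2E] : exists g, f g = y1 * phi b.
    by apply: (inR _ (X * inw (phi b)) Y); rewrite E2 E1 ?mulgA.
  exists (i g1 * g2) => _.
  by rewrite gmulfM g2E -g1E mulgA -gmulfM (iP g1).2 fe.
have [psi psiP] := choice letter.
have words w : {subset w <= cont q} -> exists g,
    inw e0 * word_value phi w = inw (f g) /\ inw e * word_value psi w = inw g.
  elim/last_ind: w => [|w b IH] sub.
    by exists e; rewrite !word_value_nil -fe.
  have [b' b'w|g [E1 E2]] := IH; first by apply: sub; rewrite mem_rcons inE b'w orbT.
  exists (g * psi b); rewrite -cats1 !word_value_cat !mulgA E1 E2.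
  rewrite !word_value_cons !word_value_nil.
  split=> //; congr inw; rewrite gmulfM -(psiP b) ?sub ?mem_rcons ?inE ?eqxx //.
  by rewrite mulgA -fe -gmulfM (eP g).2.
have words' z : cont z \subset cont q -> e0 * ev phi z = f (ev psi z).
  move=> /fintype.subsetP sub.
  have [w [E1 E2 E3]] := density3 phi psi (@content_gen A) z.
  have [b bw|g] := words w.
    by apply: sub; rewrite (cont_word_value E3) inE.
  rewrite -E1 -E2 => -[[->] [<-]].
  by rewrite (eP _).1.
have Epow : ev phi (pow q) = e0.
  have [m Nm Em] := pow_large phi q N.
  have : e0 * ev phi (pow q) = ev phi (pow q).
    by have := abk m Nm; rewrite -Em Ee0 => -[].
  rewrite words' ?cont_pow // => <-.
  by rewrite -fe -[ev psi (pow q)](eP _).1 (pow_one _ _ HG' _).2.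
exists G, f, psi, e; split=> //; first by rewrite Epow.
by move=> z /words'; rewrite Epow.
Qed.

End Pow.

(** * Closure properties of sigma-words *)

Section SigmaWords.
Variables (sigma : op_set) (A : finType).
Hypothesis sm : implicit_signature sigma.
Implicit Types (u v : pseudoword A).

Lemma sigma_mul u v : sigma_word sigma u -> sigma_word sigma v ->
  sigma_word sigma (u * v).
Proof.
move=> su sv.
have -> : u * v = subst (gen all_sgrp ord0 * gen all_sgrp ord_max)
    (fun i : 'I_2 => if i == ord0 then u else v) by apply: ev_ext.
by apply: SigmaOp => // i; case: ifP.
Qed.

Lemma sigma_subst n (pi : pseudoword 'I_n) (q : pseudoword A) :
  comp_closure sigma n pi -> sigma_word sigma q -> sigma_word sigma (pow pi q).
Proof.
move=> spi sq; elim: spi => [a|k p w sp _ IH].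
  by have -> : pow (gen all_sgrp a) q = q by apply: ev_ext.
by have -> : pow (subst p w) q = subst p (fun i => pow (w i) q);
  [apply: ev_ext | apply: SigmaOp].
Qed.

Lemma sigma_word_value (S : finsgrp) (phi : A -> S) u :
  exists2 v, sigma_word sigma v & ev phi v = ev phi u.
Proof.
have [[|a w]] := density1 phi u; first by rewrite word_value_nil.
rewrite -word_value_word => -[->]; exists (word a w) => //.
elim/last_ind: w => [|w b IH]; first exact: SigmaGen.
rewrite /word -cats1 foldl_cat /=; apply: sigma_mul => //; exact: SigmaGen.
Qed.

End SigmaWords.

(** * Values in groups *)

Section EqMod.
Variable A : finType.
Implicit Types (u v : pseudoword A) (x y : adjI (pseudoword A)) (V : sgrp_class).

Lemma eq_mod_inw V u v : eq_mod V (inw u) (inw v) <-> eqI V (inw u) (inw v).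
Proof.
split=> E.
  have {}E : rho V u = rho V v := congr1 (odflt (rho V u)) E.
  apply: ev_eqI => S phi VS.
  by rewrite -[LHS]/(op (rho V u) VS phi) E.
rewrite /eq_mod /=; congr inw; apply: OmegaP => S VS phi.
exact: eqI_ev E S phi VS.
Qed.

Definition value_or (G : finsgrp) (e : G) (psi : A -> G) x : G :=
  odflt e (evI psi x).

Lemma eq_mod_value_or V x y : group_class V -> eq_mod V x y ->
  forall (G : finsgrp) (e : G) (psi : A -> G), V G -> is_identity e ->
  value_or e psi x = value_or e psi y.
Proof.
move=> VG E G e psi VGG eP.
have hvE z X : rhoI V z = inw X -> value_or e psi z = op X VGG psi.
  case: z => [u|] /=; first by move=> [<-].
  case: pselect => // VG' [<-] /=.
  by rewrite -[RHS](eP _).1 (gid_identity _ _ _).2.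
case Ex : (rhoI V x) (E) => [X|]; rewrite /eq_mod Ex.
  by move=> /esym Ey; rewrite (hvE _ _ Ex) (hvE _ _ Ey).
by case: (x) Ex => [u|] //=; case: pselect.
Qed.

Lemma value_or_mul (G : finsgrp) (e : G) (psi : A -> G) x u : is_identity e ->
  value_or e psi (x * inw u) = value_or e psi x * ev psi u.
Proof. by move=> eP; case: x => [v|] //=; rewrite (eP _).1. Qed.

End EqMod.

(** * Replacing families constant modulo H by sigma-words *)

Lemma Forall2_nth (T U : Type) (R : T -> U -> Prop) t0 u0 s s' :
  size s = size s' -> (forall k, k < size s -> R (nth t0 s k) (nth u0 s' k)) ->
  List.Forall2 R s s'.
Proof.
elim: s s' => [|t s IH] [|u s'] //= [E] P; constructor; first exact: (P 0).
by apply: IH => // k; apply: (P k.+1).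
Qed.

Lemma Forall_nth (T : Type) (R : T -> Prop) t0 s :
  List.Forall R s -> forall k, k < size s -> R (nth t0 s k).
Proof. by elim=> {s} // t s Rt _ IH [|k] //=; exact: IH. Qed.

Section Families.
Variables (A J : finType).
Implicit Types (u v w r : J -> pseudoword A) (rs : seq (J -> pseudoword A)).

Definition constant_mod (V : sgrp_class) r :=
  forall i j, eqI V (inw (r i)) (inw (r j)).

Definition family_prod rs (i : J) : adjI (pseudoword A) :=
  \prod_(r <- rs) inw (r i).

Lemma family_prod_cat rs rs' i :
  family_prod (rs ++ rs') i = family_prod rs i * family_prod rs' i.
Proof. by rewrite /family_prod big_cat. Qed.

Lemma family_prod1 r i : family_prod [:: r] i = inw (r i).
Proof. by rewrite /family_prod big_seq1. Qed.

Definition is_one (H : sgrp_class) (x : adjI (pseudoword A)) :=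
  forall (G : finsgrp) (psi : A -> G), H G ->
  exists2 g, evI psi x = inw g & is_identity g.

End Families.

Section Reduction.
Variables (H : sgrp_class) (sigma : op_set).
Hypotheses (HG : group_pseudovariety H)
  (hred : reducible sigma H graph_systems).
Variables (A J : finType) (i0 : J) (T : finsgrp) (phi : A -> T).
Implicit Types (u v w r : J -> pseudoword A) (rs : seq (J -> pseudoword A)).

Definition replacement (V : sgrp_class) r r' :=
  [/\ forall i, sigma_word sigma (r' i), forall i, ev phi (r' i) = ev phi (r i) &
      constant_mod V r'].

(** The families r_0, ..., r_(m-1) label the edges k -> k+1 of a path, one edge for
    each index in J; with [cyc] the last step returns to vertex 0. A solution
    modulo H is given by the partial products at the vertices, which close up
    when the whole product is 1. In the solution by sigma-words the vertices get
    arbitrary values, and cancelling them modulo H shows that parallel edges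
    have equal labels and that the labels along the cycle multiply to 1. *)
Lemma group_replacement (cyc : bool) rs : List.Forall (constant_mod H) rs ->
  (cyc -> forall i, is_one H (family_prod rs i)) ->
  exists rs', List.Forall2 (replacement H) rs rs' /\
    (cyc -> forall i, is_one H (family_prod rs' i)).
Proof.
case: rs => [|r1 rs0] cH oneH; first by exists [::].
set rs := r1 :: rs0 in cH oneH *; pose m' := size rs0; pose m := m'.+1.
have [a0 _] := pseudoword_letter (r1 i0).
pose r k := nth r1 rs k.
have rH k : k < m -> constant_mod H (r k) by move=> km; exact: Forall_nth cH k km.
(* The partial products start with a letter only to be nonempty. *)
pose vv k := foldl (fun acc r => acc * r i0) (gen all_sgrp a0) (take k rs).
have vvS k : k < m -> vv k.+1 = vv k * r k i0.
  by move=> km; rewrite /vv (take_nth r1) // -cats1 foldl_cat.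
have vvE k : inw (vv k) = inw (gen all_sgrp a0) * family_prod (take k rs) i0.
  rewrite /vv; elim/last_ind: (take k rs) => [|s x IH].
    by rewrite /family_prod big_nil mulg1.
  by rewrite -cats1 foldl_cat family_prod_cat mulgA -IH family_prod1.
pose tgt (k : nat) : nat := if cyc && (k == m') then 0 else k.+1.
have tgtm k : k < m -> tgt k < m.+1 by rewrite /tgt => km; case: ifP.
pose Gamma := @Digraph 'I_m.+1 ('I_m * J)%type
  (fun e => widen_ord (leqnSn m) e.1) (fun e => inord (tgt e.1)).
pose K (x : vars (graph_system Gamma)) : set (adjI (pseudoword A)) :=
  match x with
  | inl _ => setT
  | inr e => [set z | evI phi z = inw (ev phi (r (nat_of_ord e.1) e.2))]
  end.
pose theta (x : vars (graph_system Gamma)) : adjI (pseudoword A) :=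
  match x with
  | inl v => inw (vv (nat_of_ord v))
  | inr e => inw (r (nat_of_ord e.1) e.2)
  end.
have Kc x : clopen (K x) by case: x => [v|e]; [exact: clopenT|exact: clopen_ev].
have [|d' [[_ d'E d'K] d'S]] := hred (ex_intro _ Gamma erefl) Kc.
  have [d [dc dE]] := substitution_exists theta; exists d; split=> //; last first.
    by move=> [v|e]; rewrite dE.
  move=> x y /mapP[[k i] _ [-> ->]]; rewrite gmulfM !dE /=.
  rewrite -[_ * _]/(inw (vv k * r k i)).
  apply/eq_mod_inw; rewrite inordK ?tgtm //.
  apply: (@eqI_trans _ _ _ (inw (vv k.+1))).
    rewrite vvS //; apply: (eqI_mulw) => //.
    exact: rH.
  rewrite /tgt; case: ifP => // /andP[c /eqP km].
  rewrite !vvE take0 take_oversize ?km //.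
  move=> G psi HGG; rewrite !evIM.
  have [g -> gP] := oneH c i0 G psi HGG.
  by rewrite /family_prod big_nil /=; congr inw; rewrite (gP _).2.
have /choice[w wP] : forall e : 'I_m * J, exists z, [/\ sigma_word sigma z,
    d' (gen all_sgrp (inr e)) = inw z & ev phi z = ev phi (r e.1 e.2)].
  move=> e; have := d'K (inr e).
  case: (d'S (inr e)) => [->|[z sz zE]]; first by [].
  by rewrite /= zE => -[E]; exists z.
pose w' k i := w (inord k, i).
have wE k i (G : finsgrp) (e : G) (psi : A -> G) : k < m -> H G -> is_identity e ->
   value_or e psi (d' (gen all_sgrp (inl (inord k)))) * ev psi (w' k i) =
   value_or e psi (d' (gen all_sgrp (inl (inord (tgt k))))).
  move=> km HGG eP.
  have [_ wz _] := wP (inord k, i); rewrite -value_or_mul // -wz -gmulfM.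
  have := @d'E (gen all_sgrp (inl (inord k)) * gen all_sgrp (inr (inord k, i)))
    (gen all_sgrp (inl (inord (tgt k)))).
  move=> /(_ _)/(eq_mod_value_or HG.2)-> //; apply/mapP.
  exists (inord k, i); rewrite ?mem_enum //=; congr (_, _).
    congr (gen _ (inl _) * _); apply: val_inj.
    by rewrite /= !inordK // ltnW.
  by rewrite inordK.
exists (mkseq w' m); split.
  apply: (Forall2_nth (t0 := r1) (u0 := r1)); rewrite ?size_mkseq // => k km.
  rewrite nth_mkseq //; split=> [i|i|i j].
  - by have [] := wP (inord k, i).
  - by have [_ _] := wP (inord k, i); rewrite /= inordK.
  apply: ev_eqI => G psi HGG.
  have [e [_ [eP _ _]]] := group_inverse (HG.2 G HGG).
  apply: (group_cancel (g := value_or e psi (d' (gen all_sgrp (inl (inord k)))))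
    (HG.2 G HGG)).
  by rewrite (wE k i _ e) // (wE k j _ e).
move=> c i G psi HGG.
have [e [_ [eP _ _]]] := group_inverse (HG.2 G HGG).
pose g k := value_or e psi (d' (gen all_sgrp (inl (inord k)))).
have gE k : k < m ->
    inw (g 0) * evI psi (\prod_(l <- iota 0 k) inw (w' l i)) = inw (g k).
  elim: k => [|k IH] km; first by rewrite big_nil.
  rewrite -addn1 iotaD big_cat evIM mulgA IH ?(ltnW km) // big_seq1 add0n.
  rewrite -[_ * _]/(inw (g k * ev psi (w' k i))) (wE k i) ?(ltnW km) //.
  by rewrite /tgt addn1 (ltn_eqF (km : k < m')) andbF.
have gm : inw (g 0) * evI psi (family_prod (mkseq w' m) i) = inw (g 0).
  have iS : iota 0 m = iota 0 m' ++ [:: m'] by rewrite /m -addn1 iotaD.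
  rewrite /family_prod big_map iS big_cat evIM mulgA gE // big_seq1.
  rewrite -[_ * _]/(inw (g m' * ev psi (w' m' i))) (wE m' i) //.
  by rewrite /tgt c eqxx.
have [p pE] : exists p, evI psi (family_prod (mkseq w' m) i) = inw p.
  rewrite /mkseq /= /family_prod big_cons evIM.
  by case: (evI psi (\big[_/_]_(_ <- _) _)) => [p|]; eexists.
exists p => //; move: gm; rewrite pE => -[gp].
have -> : p = e by apply: (group_cancel (g := g 0) (HG.2 G HGG)); rewrite gp (eP _).2.
exact: eP.
Qed.

End Reduction.

(** * Families constant modulo DRH *)

Section Decomposition.
Variables (H : sgrp_class) (sigma : op_set) (n : nat) (eta : pseudoword 'I_n).
Hypotheses (HG : group_pseudovariety H) (sm : implicit_signature sigma)
  (seta : comp_closure sigma n eta) (nex : ~ explicit_op eta)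
  (one : op_one_in eta H) (hred : reducible sigma H graph_systems).
Variables (A J : finType) (i0 : J) (T : finsgrp) (phi : A -> T).
Hypotheses
  (phi_letter : forall u a, ev phi u = ev phi (gen all_sgrp a) -> u = gen all_sgrp a)
  (phi_cont : forall u v, ev phi u = ev phi v -> cont u = cont v).
Implicit Types (u v w r p q z : J -> pseudoword A)
  (rs : seq (J -> pseudoword A)).

Local Notation DRH := (DRH H).
Local Notation replacement := (replacement sigma phi).

(** The sigma-words w are determined only after the replacements of the families
    rs have been chosen, and their value modulo H is controlled by these. This
    leaves the freedom to choose all replacements simultaneously, with product
    1 modulo H. *)
Definition realizable (idem : bool) u := exists rs,
  [/\ List.Forall (constant_mod H) rs,
      forall i, eqI H (inw (u i)) (family_prod rs i) &
      forall rs', List.Forall2 (replacement H) rs rs' -> exists w,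
        [/\ replacement DRH u w, forall i, eqI H (inw (w i)) (family_prod rs' i) &
            idem -> (forall i, is_one H (family_prod rs' i)) ->
            forall i, eqI DRH (inw (w i)) (inw (w i * w i))]].

Lemma realizable_weak idem u : realizable idem u -> realizable false u.
Proof.
move=> [rs [cH uE R]]; exists rs; split=> // rs' /R[w [aw wE _]].
by exists w.
Qed.

(** A letter is its own only replacement, because phi isolates it. *)
Lemma realizable_gen a : realizable false (fun=> gen all_sgrp a).
Proof.
exists [:: fun=> gen all_sgrp a]; split.
- by constructor=> // i j; exact: eqI_refl.
- by move=> i; rewrite family_prod1.
move=> rs' R; inversion_clear R as [|? r' ? l [sr er cr] R'].
inversion_clear R'; exists r'.
have r'E i : r' i = gen all_sgrp a by apply: phi_letter; exact: er.
split=> // [|i]; last by rewrite family_prod1.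
by split=> // i j; rewrite !r'E.
Qed.

Lemma realizable_mul u v : realizable false u -> realizable false v ->
  realizable false (fun i => u i * v i).
Proof.
move=> [rs [cu uE R]] [ss [cv vE S]]; exists (rs ++ ss); split.
- by apply/List.Forall_app.
- move=> i; rewrite family_prod_cat.
  exact: (eqI_mul (x := inw _) (y := inw _) (uE i) (vE i)).
move=> rs1 /List.Forall2_app_inv_l[rs' [ss' [/R[w [[sw ew cw] wE _]]]]].
move=> [/S[w' [[sw' ew' cw'] wE' _]] ->].
exists (fun i => w i * w' i); split=> //.
  split=> [i|i|i j]; first exact: sigma_mul.
    by rewrite !evM ew ew'.
  exact: (eqI_mulw
    (cw i j) (cw' i j)).
move=> i; rewrite family_prod_cat.
exact: (eqI_mul (x := inw _) (y := inw _) (wE i) (wE' i)).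
Qed.

Lemma realizable_sigma u : realizable false u -> exists w, replacement DRH u w.
Proof.
move=> [rs [cu _ R]].
have [//|rs' [/R[w [aw _ _]] _]] :=
  group_replacement HG hred i0 phi (cyc := false) cu.
by exists w.
Qed.

Lemma ev_pow_eq (S : finsgrp) (chi : A -> S) (q q' : pseudoword A) :
  ev chi q = ev chi q' -> ev chi (pow eta q) = ev chi (pow eta q').
Proof. by move=> E; rewrite -[LHS]/(ev (fun=> ev chi q) eta) E. Qed.

(** The sigma-words are p' eta(q') r'. Modulo H the middle factor is 1,
    so q' does not contribute to the value modulo H and can be fixed at once;
    only p' and r' are left to the replacements. *)
Lemma realizable_regular p q r : realizable false p -> realizable false q ->
  constant_mod H r ->
  (forall i, ev phi (p i) * ev phi (q i) = ev phi (p i)) ->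
  (forall i j, cont (p i) \subset cont (q j)) ->
  (forall i j, cont (r i) \subset cont (q j)) ->
  realizable true (fun i => p i * r i).
Proof.
move=> [rs [cp pE R]] /realizable_sigma[q' [sq eq cq]] cr pq cpq crq.
exists (rs ++ [:: r]); split.
- by apply/List.Forall_app; split=> //; constructor.
- move=> i; rewrite family_prod_cat family_prod1.
  exact: (eqI_mul (x := inw _) (y := inw _) (pE i) (eqI_refl _)).
move=> rs1 /List.Forall2_app_inv_l[rs' [ss' [/R[p' [[sp ep cp'] pE' _]]]]].
move=> [R' ->]; inversion_clear R' as [|? r' ? l [sr er cr'] R''].
inversion_clear R'' => {R ss'}.
have cqq i : cont (q' i) = cont (q i) by exact: phi_cont.
have crq' i j : cont (r' i) \subset cont (q' j).
  by rewrite cqq (phi_cont (er i)).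
have cpq' i j : cont (p' i) \subset cont (q' j).
  by rewrite cqq (phi_cont (ep i)).
have HE i (G : finsgrp) (psi : A -> G) : H G ->
    ev psi (p' i * pow eta (q' i) * r' i) = ev psi (p' i * r' i).
  move=> HGG; rewrite !evM.
  by rewrite (pow_one one psi (q' i) HGG _).2.
have pE'' i : eqI H (inw (p' i * r' i)) (family_prod (rs' ++ [:: r']) i).
  rewrite family_prod_cat family_prod1.
  exact: (eqI_mul (x := inw _) (y := inw _) (pE' i) (eqI_refl _)).
exists (fun i => p' i * pow eta (q' i) * r' i); split.
- split=> [i|i|i j].
  + by do 2?[apply: sigma_mul => //]; exact: sigma_subst.
  + rewrite !evM er; congr (_ * _); rewrite -ep.
    by apply: (pow_stab nex); rewrite ep eq.
  apply: ev_eqI => S chi DS; rewrite !evM.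
  rewrite (eqI_ev (cp' i j) _ DS) -!mulgA; congr (_ * _).
  rewrite (ev_pow_eq (eqI_ev (cq i j) _ DS)).
  have [G [f [psi [e [HGG eP _ absE]]]]] :=
    pow_absorbs_into_group HG nex one chi (q' j) DS.
  by rewrite !absE // (eqI_ev (cr' i j) psi HGG).
- move=> i; apply: eqI_trans (pE'' i).
  by apply: ev_eqI => G psi HGG; exact: HE.
move=> _ oneH i; apply: ev_eqI => S chi DS.
have [G [f [psi [e [HGG eP powE absE]]]]] :=
  pow_absorbs_into_group HG nex one chi (q' i) DS.
have [g gE gP] := oneH i G psi HGG.
have prE : is_identity (ev psi (r' i * p' i)).
  have E : ev psi (p' i * r' i) = g :=
    congr1 (odflt g) (etrans (pE'' i G psi HGG) gE).
  by rewrite evM; apply: group_swap (HG.2 G HGG) _; rewrite -evM E.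
(* In the group of the R-class of e, the value of [pow eta (q' i)], both e and
   e r p are the identity; so (p e r) (p e r) = p (e r p) e r = p e r. *)
have Erp : ev chi (pow eta (q' i)) * ev chi (r' i * p' i) =
    ev chi (pow eta (q' i)).
  rewrite absE; last by rewrite contM finset.subUset crq' cpq'.
  by rewrite powE -[ev psi _](eP _).1 (prE _).2.
have Epp : ev chi (pow eta (q' i)) * ev chi (pow eta (q' i)) =
    ev chi (pow eta (q' i)).
  by rewrite powE -gmulfM (eP e).1.
rewrite !evM -!mulgA; congr (_ * _).
by rewrite !mulgA -(mulgA _ (ev chi (r' i))) -evM Erp Epp.
Qed.

Lemma family_cases (x : J -> adjI (pseudoword A)) :
  (forall i j, eqI DRH (x i) (x j)) ->
  (forall i, x i = emptyw) \/
  exists x', constant_mod DRH x' /\ forall i, x i = inw (x' i).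
Proof.
move=> cx; case E : (x i0) => [t|]; last first.
  by left=> i; have := cx i i0; rewrite E => /(eqI_emptyw HG).
right; have get i : exists t, x i = inw t.
  case Ei : (x i) => [t'|]; first by exists t'.
  by have := cx i0 i; rewrite Ei => /(eqI_emptyw HG); rewrite E.
have [x' x'E] := choice get; exists x'; split=> // i j.
by rewrite -!x'E.
Qed.

Lemma left_basic_factorization_family u : constant_mod DRH u ->
  exists a (x y : J -> adjI (pseudoword A)),
  [/\ forall i, inw (u i) = x i * inw (gen all_sgrp a) * y i,
      (forall i, a \notin contI (x i)) /\ a \in cont (u i0),
      forall i, contI (x i) = cont (u i0) :\ a,
      forall i j, eqI DRH (x i) (x j) & forall i j, eqI DRH (y i) (y j)].
Proof.
move=> cu; have [a [x0 [y0 [uE ax0 au cx0]]]] := left_basic_factorization (u i0).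
have cont_u i : cont (u i) = cont (u i0) := eqI_cont HG (cu i i0).
have /choice[x /choice[y xyP]] : forall i, exists x y,
    inw (u i) = x * inw (gen all_sgrp a) * y /\ a \notin contI x.
  by move=> i; apply: split_at_letter; rewrite cont_u.
have uniq i j : eqI DRH (x i) (x j) /\ eqI DRH (y i) (y j).
  have [[Ei ai] [Ej aj]] := (xyP i, xyP j).
  by apply: (split_uniq HG (a := a)) => //; rewrite -Ei -Ej.
exists a, x, y; split=> [i|||i j|i j]; try by have [] := uniq i j.
- by have [] := xyP i.
- by split=> // i; have [] := xyP i.
move=> i; rewrite -cx0; apply: (eqI_cont HG).
have [Ei ai] := xyP i.
suff [] : eqI DRH (x i) x0 /\ eqI DRH (y i) y0 by [].
by apply: (split_uniq HG (a := a)) => //; rewrite -Ei -uE.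
Qed.

(** Idempotents are recurrent, and recurrence passes from u to the remainder of its
    left basic factorization; it keeps the content of the remainder equal to
    that of u. *)
Definition recurrent u := exists v : pseudoword A,
  eqI DRH (inw (u i0 * v)) (inw (u i0)) /\ cont (u i0) \subset cont v.

Definition block (B : {set A}) z :=
  [/\ realizable false z, constant_mod DRH z & forall i, cont (z i) = B].

(** Iterate the left basic factorization: as long as the remainder has content B
    one more block splits off; once the remainder is empty or has a smaller
    content, u is a product of realizable pieces, and the content of the
    remainder excludes recurrence. *)
Lemma blocks (B : {set A}) :
  (forall x, constant_mod DRH x -> #|cont (x i0)| < #|B| -> realizable false x) ->
  forall K u, constant_mod DRH u -> cont (u i0) = B ->
  (realizable false u /\ ~ recurrent u) \/
  exists zs y, [/\ size zs = K, List.Forall (block B) zs, constant_mod DRH y,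
    cont (y i0) = B & forall i, inw (u i) = family_prod zs i * inw (y i)].
Proof.
move=> IHB; elim=> [|K IH] u cu uB.
  right; exists [::], u; split=> //.
  by move=> i; rewrite /family_prod big_nil mul1g.
have [a [x [y [uE [ax au] cx cxx cyy]]]] := left_basic_factorization_family cu.
rewrite uB in au cx.
have [z [zE zR]] : exists z, (forall i, inw (z i) = x i * inw (gen all_sgrp a)) /\
    realizable false z.
  have [x0|[x' [cx' x'E]]] := family_cases cxx.
    exists (fun=> gen all_sgrp a); split; last exact: realizable_gen.
    by move=> i; rewrite x0.
  exists (fun i => x' i * gen all_sgrp a); split; first by move=> i; rewrite x'E.
  apply: (realizable_mul (v := fun=> _)) (realizable_gen a); apply: IHB => //.
  by rewrite -[cont _]/(contI (inw (x' i0))) -x'E cx (cardsD1 a B) au.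
have zB : block B z.
  split=> // [i j|i].
    rewrite !zE; apply: eqI_mul => //; exact: eqI_refl.
  rewrite -[cont _]/(contI (inw (z i))) zE contIM cx /= cont_gen.
  by rewrite finset.setUC finset.setD1K.
have recE (v : pseudoword A) : eqI DRH (inw (u i0 * v)) (inw (u i0)) ->
    eqI DRH (y i0 * inw v) (y i0).
  rewrite -[inw (_ * _)]/(inw (u i0) * inw v) uE -mulgA => E.
  by have [] := split_uniq HG E (ax i0) (ax i0).
have [y0|[y' [cy' y'E]]] := family_cases cyy.
  left; split; last first.
    by move=> [v [/recE + _]]; rewrite y0 => /(eqI_emptyw HG).
  suff -> : u = z by [].
  by apply: funext => i; have := uE i; rewrite y0 mulg1 -zE => -[].
have uzy i : u i = z i * y' i.
  by have := uE i; rewrite y'E -zE => -[].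
have uzyE : u = (fun i => z i * y' i) by exact: funext.
have yB : cont (y' i0) \subset B.
  by rewrite -uB uzy contM finset.subsetUr.
have recy (v : pseudoword A) : eqI DRH (inw (u i0 * v)) (inw (u i0)) ->
    eqI DRH (inw (y' i0 * v)) (inw (y' i0)).
  by move=> /recE; rewrite y'E.
have [yB'|nyB] := eqVneq (cont (y' i0)) B; last first.
  left; split; last first.
    move=> [v [/recy/(eqI_cont HG) E]]; rewrite uB => Bv; case/eqP: nyB.
    apply/eqP; rewrite finset.eqEsubset yB (fintype.subset_trans Bv) //.
    by move: E => /= <-; rewrite contM finset.subsetUr.
  rewrite uzyE; case: zB => zR' _ _; apply: realizable_mul => //.
  by apply: IHB => //; apply: proper_card; rewrite finset.properEneq nyB.
have [[yR nrec]|[zs [t [szs Bzs ct tB yE]]]] := IH y' cy' yB'.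
  left; split; first by rewrite uzyE; case: zB => zR' _ _; apply: realizable_mul.
  move=> [v [/recy E cv]]; apply: nrec; exists v; split=> //.
  by rewrite yB' -uB.
right; exists (z :: zs), t; split=> //; first by rewrite /= szs.
- by constructor.
- move=> i; rewrite uzy /family_prod big_cons -mulgA.
  by rewrite -[_ * inw (t i)]/(family_prod zs i * inw (t i)) -yE.
Qed.

Lemma block_prod B z zs : List.Forall (block B) (z :: zs) ->
  exists2 p, block B p & forall i, inw (p i) = family_prod (z :: zs) i.
Proof.
move=> F; inversion_clear F as [|? ? zB zsB].
elim: zsB z zB => {zs} [|z' zs z'B _ IH] z zB.
  by exists z => // i; rewrite family_prod1.
have [p [pR cp pB] pE] := IH _ z'B; case: zB => zR cz zB.
exists (fun i => z i * p i).
  split=> [|i j|i]; first exact: realizable_mul.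
    exact: (eqI_mulw
      (cz i j) (cp i j)).
  by rewrite contM zB pB finset.setUid.
by move=> i; rewrite -[LHS]/(inw (z i) * inw (p i)) pE /family_prod [in RHS]big_cons.
Qed.

(** One more than the number of possible families of values of a prefix under phi *)
Definition num_prefixes := #|{: {ffun J -> adjI T}}|.+1.

(** Two prefixes have the same values under phi; p is the shorter one, q the
    difference between them, and r the remainder after p. *)
Lemma blocks_realizable B u zs (y : J -> pseudoword A) : constant_mod DRH u ->
  size zs = num_prefixes -> List.Forall (block B) zs -> constant_mod DRH y ->
  cont (y i0) = B -> (forall i, inw (u i) = family_prod zs i * inw (y i)) ->
  realizable true u.
Proof.
move=> cu szs zsB cy yB uE.
pose g (k : 'I_num_prefixes) : {ffun J -> adjI T} :=
  [ffun i => evI phi (family_prod (take k.+1 zs) i)].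
have [k [l [kl lN gkl]]] : exists k l : nat, [/\ k < l, l < size zs &
    forall i, evI phi (family_prod (take k.+1 zs) i) =
      evI phi (family_prod (take l.+1 zs) i)].
  have /injectivePn[k [l nkl /ffunP gkl]] : ~~ injectiveb g.
    by apply/negP => /injectiveP /leq_card; rewrite card_ord ltnn.
  have E i : evI phi (family_prod (take k.+1 zs) i) =
      evI phi (family_prod (take l.+1 zs) i).
    by have := gkl i; rewrite !ffunE.
  case: (ltngtP k l) => [lt|lt|/val_inj E']; last by rewrite E' eqxx in nkl.
  - by exists k, l; rewrite szs; split.
  - by exists l, k; rewrite szs; split.
pose zs1 := take k.+1 zs; pose zs2 := take (l - k) (drop k.+1 zs).
pose zs3 := drop k.+1 zs.
have zs13 : zs = zs1 ++ zs3 by rewrite cat_take_drop.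
have zs12 : take l.+1 zs = zs1 ++ zs2.
  by rewrite /zs1 /zs2 -takeD addSn subnKC // ltnW.
have [zs1B zs3B] : List.Forall (block B) zs1 /\ List.Forall (block B) zs3.
  by apply/List.Forall_app; rewrite -[(_ ++ _)%list]/(zs1 ++ zs3) -zs13.
have zs2B : List.Forall (block B) zs2.
  apply: (proj1 (_ : _ /\ List.Forall (block B) (drop (l - k) zs3))).
  apply/List.Forall_app.
  by rewrite -[(_ ++ _)%list]/(zs2 ++ drop (l - k) zs3) cat_take_drop.
have s1 : 0 < size zs1 by rewrite size_take; case: ifP => //; rewrite szs.
have s2 : 0 < size zs2.
  rewrite size_take size_drop; case: ifP => _; rewrite ?subn_gt0 //.
  by rewrite (leq_ltn_trans _ lN).
have [p [pR cp pB] pE] : exists2 p, block B p &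
    forall i, inw (p i) = family_prod zs1 i.
  by case: (zs1) s1 zs1B => // z zs' _; exact: block_prod.
have [q [qR cq qB] qE] : exists2 q, block B q &
    forall i, inw (q i) = family_prod zs2 i.
  by case: (zs2) s2 zs2B => // z zs' _; exact: block_prod.
have cyB i : cont (y i) = B by rewrite -yB; apply: (eqI_cont HG (cy i i0)).
have [r [rE rB]] : exists r,
    (forall i, inw (r i) = family_prod zs3 i * inw (y i)) /\
    forall i, cont (r i) = B.
  case: (zs3) zs3B => [|z zs'] F.
    by exists y; split=> // i; rewrite /family_prod big_nil mul1g.
  have [p' [_ _ p'B] p'E] := block_prod F.
  exists (fun i => p' i * y i); split=> i; first by rewrite -p'E.
  by rewrite contM p'B cyB finset.setUid.
have uE' : u = (fun i => p i * r i).
  apply: funext => i; suff [] : inw (u i) = inw (p i * r i) by [].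
  by rewrite -[RHS]/(inw (p i) * inw (r i)) uE rE pE {1}zs13 family_prod_cat mulgA.
rewrite uE'; apply: (realizable_regular (q := q)) => //.
- move=> i j; apply: ev_eqI => G psi HG'.
  have /(eqI_DRH HG)/eqI_ev E := cu i j; have := E G psi HG'.
  rewrite uE' !evM (eqI_ev (eqI_DRH HG (cp i j)) psi HG').
  exact: group_cancel (HG.2 G HG').
- move=> i; suff [] : inw (ev phi (p i) * ev phi (q i)) = inw (ev phi (p i)) by [].
  rewrite -[LHS]/(evI phi (inw (p i)) * evI phi (inw (q i))) pE qE.
  rewrite -evIM -family_prod_cat.
  by rewrite -zs12 -gkl -[RHS]/(evI phi (inw (p i))) pE.
- by move=> i j; rewrite pB qB.
- by move=> i j; rewrite rB qB.
Qed.

Lemma constant_realizable u : constant_mod DRH u -> realizable false u.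
Proof.
have [m] := ubnP #|cont (u i0)|; elim: m u => // m IH u lm cu.
have [x cx lx|[]|[zs [y [szs zsB cy yB uE]]]] :=
    @blocks (cont (u i0)) _ num_prefixes u cu erefl.
- by apply: IH => //; apply: leq_trans lx _.
- by [].
- exact: realizable_weak (blocks_realizable cu szs zsB cy yB uE).
Qed.

Lemma idempotent_reducible u : constant_mod DRH u ->
  eqI DRH (inw (u i0)) (inw (u i0 * u i0)) ->
  exists w, replacement DRH u w /\ forall i, eqI DRH (inw (w i)) (inw (w i * w i)).
Proof.
move=> cu idu.
have [x cx _|[_ []]|[zs [y [szs zsB cy yB uE]]]] :=
    @blocks (cont (u i0)) _ num_prefixes u cu erefl.
- exact: constant_realizable.
- by exists (u i0); split=> //; apply: eqI_sym.
have [rs [cH rE R]] := blocks_realizable cu szs zsB cy yB uE.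
have one_rs i : is_one H (family_prod rs i).
  move=> G psi HG'; exists (ev psi (u i)); first by rewrite -rE.
  apply: group_idem (HG.2 G HG') _.
  have E : ev psi (u i) = ev psi (u i0) := eqI_ev (eqI_DRH HG (cu i i0)) psi HG'.
  by rewrite E -evM -(eqI_ev (eqI_DRH HG idu) psi HG').
have [rs' [/R[w [aw _ idw]] one_rs']] :=
  group_replacement HG hred i0 phi (cyc := true) cH (fun _ => one_rs).
by exists w; split=> //; apply: idw => //; apply: one_rs'.
Qed.

End Decomposition.

(** * Pointlike systems *)

Section LetterSemigroup.
Variable A : finType.

Fact letter_mulA : associative (fun _ _ : option A => @None A).
Proof. by []. Qed.

Definition letter_sgrp : finsgrp := table letter_mulA None.
Definition letter_gen (a : A) : letter_sgrp := enc letter_mulA None (Some a).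

(** In the null semigroup on the letters, a word of length at least two is zero. *)
Lemma letter_isolated (u : pseudoword A) a :
  ev letter_gen u = ev letter_gen (gen all_sgrp a) -> u = gen all_sgrp a.
Proof.
rewrite ev_gen => ua; apply: ev_ext => S phi.
have [w [E1 E2]] := density2 letter_gen phi u; move: E1; rewrite ua.
case: w E2 => [|b [|c w]] E2; rewrite ?word_value_cons ?word_value_nil //.
  move=> [/(can_inj (encK _ _))[ab]].
  by move: E2; rewrite word_value_cons word_value_nil -ab => -[].
have [t ->] : exists t, inw (letter_gen c) * word_value letter_gen w = inw t.
  by case: word_value => [t|]; eexists.
by move=> [] /(congr1 (@dec _ _ letter_mulA None)); rewrite decM encK.
Qed.

End LetterSemigroup.

Section Pointlike.
Variables (H : sgrp_class) (A : finType).
Hypothesis HG : group_pseudovariety H.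

(** DRH contains a two-element semilattice, so the empty word is kept apart. *)
Lemma eq_mod_DRH (x y : adjI (pseudoword A)) :
  eq_mod (DRH H) x y <-> eqI (DRH H) x y.
Proof.
have rhoN : rhoI (DRH H) (emptyw : adjI (pseudoword A)) = emptyw.
  by rewrite /rhoI; case: pselect => // VG; case: (not_group_DRH HG VG).
case: x y => [u|] [v|]; first exact: eq_mod_inw.
- rewrite /eq_mod [RHS]rhoN; split=> //.
  by move=> /(_ _ (@content_gen A) (content_DRH HG (A:=A))).
- rewrite /eq_mod [LHS]rhoN; split=> //.
  by move=> /(_ _ (@content_gen A) (content_DRH HG (A:=A))).
- by split.
Qed.

Lemma pairmap_eq (X T : eqType) (U : Type) (g : X -> T) (h : T -> U) x s :
  (forall u v, (u, v) \in pairmap (fun y z => (g y, g z)) x s -> h u = h v) <->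
  (forall y, y \in x :: s -> h (g y) = h (g x)).
Proof.
elim: s x => [|z s IH] x /=; first by split=> // _ y; rewrite inE => /eqP->.
split=> [E y|E u v].
  rewrite inE => /predU1P[-> //|yz].
  rewrite (E (g x) (g z)) ?mem_head //.
  by apply: (IH z).1 y yz => u v uv; apply: E; rewrite inE uv orbT.
rewrite inE => /predU1P[[-> ->]|]; first by rewrite (E z) // !inE eqxx orbT.
apply: (IH z).2 u v => y yz; rewrite (E y) ?(E z) //.
  by rewrite !inE eqxx orbT.
by rewrite inE yz orbT.
Qed.

End Pointlike.

Theorem theorem5p7 (H : sgrp_class) (sigma : op_set) :
  group_pseudovariety H -> re_class H ->
  implicit_signature sigma -> highly_computable sigma ->
  (exists (n : nat) (eta : pseudoword 'I_n),
     [/\ comp_closure sigma n eta, ~ explicit_op eta & op_one_in eta H]) ->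
  reducible sigma H graph_systems ->
  reducible sigma (DRH H) idempotent_pointlike_systems.
Proof.
move=> HG _ sm _ [n [eta [seta nex one]]] hred Sys [X [x0 [s ->]]] A K Kc.
move=> [d [_ dE dK]].
pose g (y : X) := gen all_sgrp y.
suff [theta [thK thS thE thI]] : exists theta : X -> adjI (pseudoword A),
    [/\ forall x, K x (theta x),
        forall x, theta x = emptyw \/
          exists2 w, sigma_word sigma w & theta x = inw w,
        forall y, y \in x0 :: s -> eq_mod (DRH H) (theta y) (theta x0) &
        eq_mod (DRH H) (theta (last x0 s))
          (theta (last x0 s) * theta (last x0 s))].
  have [d' [d'c d'E]] := substitution_exists theta; exists d'; split; last first.
    by move=> x; rewrite d'E.
  split=> [|u v|x]; [exact: d'c| |by rewrite d'E].
  rewrite mem_rcons inE => /predU1P[[-> ->]|]; first by rewrite gmulfM !d'E.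
  apply: (((pairmap_eq g (fun z => rhoI (DRH H) (d' z)) x0 s).2 _) u v) => y ys.
  by rewrite !d'E; apply: thE.
have dxx0 y : y \in x0 :: s -> eqI (DRH H) (d (g y)) (d (g x0)).
  move=> ys; apply/eq_mod_DRH => //.
  apply: ((pairmap_eq g (fun z => rhoI (DRH H) (d z)) x0 s).1 _ y ys) => u v uv.
  by apply: dE; rewrite mem_rcons inE uv orbT.
have dlast : eqI (DRH H) (d (g (last x0 s)))
    (d (g (last x0 s)) * d (g (last x0 s))).
  apply/eq_mod_DRH => //; rewrite -gmulfM; apply: dE.
  by rewrite mem_rcons inE eqxx.
have tA : associative (fun _ _ : unit => tt) by [].
have /choice[P PK] : forall x, exists P : {S : finsgrp & A -> S},
    forall v, d (g x) = inw v -> forall v', ev (projT2 P) v' = ev (projT2 P) v ->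
    K x (inw v').
  move=> x; case E : (d (g x)) => [v|]; last first.
    by exists (existT (fun S : finsgrp => A -> S) (table tA tt)
      (fun=> enc tA tt tt)).
  have Kv : K x (inw v) by rewrite -[inw v]E; apply: dK.
  have [S [phi L]] := open_local (Kc x).1 Kv.
  by exists (existT _ S phi) => _ [<-]; exact: L.
have /choice[apx apxP] : forall x, exists z, K x z /\
    (z = emptyw \/ exists2 w, sigma_word sigma w & z = inw w).
  move=> x; case E : (d (g x)) => [v|].
    have [w sw we] := sigma_word_value sm (projT2 (P x)) v.
    by exists (inw w); split; [exact: PK we|right; exists w].
  by exists emptyw; split; [rewrite -[emptyw]E; apply: dK|left].
have lastP : last x0 s \in x0 :: s by exact: mem_last.
case Ex0 : (d (g x0)) => [u0|]; last first.
  have dN y : y \in x0 :: s -> d (g y) = emptyw.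
    by move=> /dxx0; rewrite Ex0; apply: eqI_emptyw.
  exists (fun y => if y \in x0 :: s then emptyw else apx y); split=> [x|x|y ->|].
  - by case: ifP => [xs|_]; [rewrite -(dN x xs); apply: dK|have [] := apxP x].
  - by case: ifP => [xs|_]; [left|have [] := apxP x].
  - by rewrite mem_head.
  - by rewrite lastP.
(* Extended by u0 to the variables outside of the list, so that the family is
   indexed by all the variables. *)
pose u y := if y \in x0 :: s then odflt u0 (d (g y)) else u0.
have uE y : y \in x0 :: s -> d (g y) = inw (u y).
  rewrite /u => ys; rewrite ys; case E : (d (g y)) => [v|] //.
  have := eqI_sym (dxx0 y ys); rewrite E Ex0.
  by move=> /(eqI_emptyw HG).
have ux0 : u x0 = u0 by rewrite /u mem_head Ex0.
have uc0 y : eqI (DRH H) (inw (u y)) (inw u0).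
  have [ys|ys] := boolP (y \in x0 :: s); last first.
    by rewrite /u (negbTE ys); exact: eqI_refl.
  by rewrite -uE // -[inw u0]Ex0; exact: dxx0.
have uc : constant_mod (DRH H) u.
  by move=> i j; apply: eqI_trans (uc0 i) (eqI_sym (uc0 j)).
have uidem : eqI (DRH H) (inw (u x0)) (inw (u x0 * u x0)).
  apply: eqI_trans (uc x0 (last x0 s)) _; rewrite -uE //.
  apply: eqI_trans dlast _; rewrite uE //.
  exact: (eqI_mulw
    (uc _ _) (uc _ _)).
pose Q (i : option (option X)) : {S : finsgrp & A -> S} :=
  match i with
  | None => existT _ (letter_sgrp A) (@letter_gen A)
  | Some None => existT _ (content_sgrp A) (@content_gen A)
  | Some (Some x) => P x
  end.
have [T [phi [f fE]]] := dominate (fun i => projT2 (Q i)).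
have phiQ i v v' : ev phi v = ev phi v' ->
    ev (projT2 (Q i)) v = ev (projT2 (Q i)) v'.
  by move=> E; rewrite fE -!ev_nat E.
have phi_letter v a : ev phi v = ev phi (gen all_sgrp a) -> v = gen all_sgrp a.
  by move=> /(phiQ None); exact: letter_isolated.
have phi_cont v v' : ev phi v = ev phi v' -> cont v = cont v'.
  by move=> /(phiQ (Some None)) E; rewrite /cont; congr dec.
have [w [[sw ew cw] widem]] := idempotent_reducible HG sm seta nex one hred
  phi_letter phi_cont uc uidem.
exists (fun y => if y \in x0 :: s then inw (w y) else apx y); split=> [x|x|y ys|].
- case: ifP => [xs|_]; last by have [] := apxP x.
  by apply: (PK x _ (uE x xs)); apply: (phiQ (Some (Some x))).
- case: ifP => [xs|_]; last by have [] := apxP x.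
  by right; exists (w x).
- by rewrite ys mem_head; apply/eq_mod_DRH.
- by rewrite lastP; apply/eq_mod_DRH.
Qed.
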